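(* Let $\theta=\mathbb{P}(g(\omega)>c)$. Suppose there exist a constant $\eta\ge 1$ and a function $\sigma^2(\cdot)\ge 0$ such that for any $y\in\Omega$ (and every inner sample size $m$), $\mathrm{Var}(\hat g_m(y))\le \sigma^2(y)/m^\eta$. Assume moreover: (i) $g(\omega)$ has a probability density function; the joint density $p_m(x,y)$ of $g(\omega)$ and $m^{\eta/2}[\hat g_m(\omega)-g(\omega)]$ and the partial derivatives $\frac{\partial}{\partial x}p_m(x,y)$, $\frac{\partial^2}{\partial x^2}p_m(x,y)$ exist for each $m$ and $(x,y)$; and for each $m\ge1$ there exist functions $f_{i,m}(\cdot)$ such that $\left|\frac{\partial^i}{\partial x^i}p_m(x,y)\right|\le f_{i,m}(y)$ for $i=0,1,2$, with $\sup_{m\ge1}\int|y|^rf_{i,m}(y)\,dy<\infty$ for $i=0,1,2$ and $0\le r\le4$. (ii) The random variable $|g(\omega)-c|/\sigma(\omega)$, where $\sigma(\omega)$ is the square root of $\sigma^2(\omega)$, has a density $\rho(\cdot)$, and there exist constants $\rho_0>0$, $x_0>0$ with $\rho(x)\le\rho_0$ for all $x\in[0,x_0]$. Then there is a constant $c_4>0$ such that for any $0<\epsilon<1/e$ there are a number of levels $L$ and sample sizes $N_0,\dots,N_L$ for which the multilevel estimator $\hat\theta_{\mathrm{MLMC}}$ satisfies $\mathbb{E}[(\hat\theta_{\mathrm{MLMC}}-\theta)^2]\le\epsilon^2$ with total computational cost $C$ satisfying $$C\le\begin{cases}c_4\,\epsilon^{-2},&\eta>2,\\ c_4\,\epsilon^{-2}(\log\epsilon)^2,&\eta=2,\\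 c_4\,\epsilon^{-3/2-1/\eta},&\eta\in[1,2).\end{cases}$$
   Context: $\omega$ is a multidimensional random variable with set of possible scenarios $\Omega$, $X$ is a one-dimensional random variable, $g(\omega)=\mathbb{E}[X\mid\omega]$, and $c$ is a given real constant. Given $\omega=y\in\Omega$, $X$ is generated as $X(y)=\psi(\boldsymbol u;y)$ with $\boldsymbol u$ uniform on $[0,1)^d$, so that $g(y)=\int_{[0,1)^d}\psi(\boldsymbol u;y)\,d\boldsymbol u$. For a sample size $m$, the inner estimator is $\hat g_m(y)=\frac1m\sum_{j=1}^m\psi(\boldsymbol u_j;y)$, where $\boldsymbol u_1,\dots,\boldsymbol u_m$ are either i.i.d. uniform points on $[0,1)^d$ (Monte Carlo) or randomized quasi-Monte Carlo points, the randomness of the points being independent of $\omega$; in both settings $\mathbb{E}[\hat g_m(y)]=g(y)$ for all $y$. The variance $\mathrm{Var}(\hat g_m(y))$ is taken over the random points for fixed $y$. Multilevel estimator: let $m_\ell=2^{\ell+\ell_0}$ with a fixed integer $\ell_0\ge0$, $P_\ell=\mathbb{I}\{\hat g_{m_\ell}(\omega)>c\}$, $Y_0=P_0$, and $Y_\ell=P_\ell-P_{\ell-1}$ for $\ell\ge1$ (both terms using the same scenario $\omega$). Then $\hat\theta_{\mathrm{MLMC}}=\sum_{\ell=0}^L\frac1{N_\ell}\sum_{i=1}^{N_\ell}Y_\ell^{(i)}$, where $Y_\ell^{(1)},\dots,Y_\ell^{(N_\ell)}$ are i.i.d. replications of $Y_\ell$, independently across levels. The cost $C_\ell$ of one sample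 of $Y_\ell$ is $O(m_\ell)$, and the total cost is $C=\sum_{\ell=0}^LN_\ell C_\ell$. *)

(* Defs.v *)
From HB Require Import structures.
From mathcomp Require Import all_boot all_order all_algebra.
From mathcomp Require Import all_classical all_reals all_analysis.

Set Implicit Arguments.
Unset Strict Implicit.
Unset Printing Implicit Defensive.

Import Order.TTheory GRing.Theory Num.Theory.
Import numFieldNormedType.Exports.

Local Open Scope classical_set_scope.
Local Open Scope ring_scope.

(* [measurableTypeR R] is [R] with the display used by [uniform_prob]. *)
Definition cons_pair (R : realType) (d : nat)
  (x : measurableTypeR R * d.-tuple R) : d.+1.-tuple R := [tuple of x.1 :: x.2].

Lemma measurable_cons_pair (R : realType) (d : nat) :
  measurable_fun setT (@cons_pair R d).
Proof.
apply: (@measurable_cons _ _ _ R fst d snd); last exact: measurable_snd.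
exact: (measurable_fst : measurable_fun setT (@fst (measurableTypeR R) _)).
Qed.

HB.instance Definition _ (R : realType) (d : nat) :=
  isMeasurableFun.Build _ _ _ _ (@cons_pair R d)
    (@measurable_cons_pair R d).

(* The uniform distribution on [0,1)^d, as a law on d-tuples.
   [uniform_prob] puts its mass on the closed interval, which is the same law:
   see [uniform_cube_box]. *)
Fixpoint uniform_cube (R : realType) (d : nat) : probability (d.-tuple R) R :=
  match d with
  | 0 => \d_([tuple] : 0.-tuple R)
  | d'.+1 => distribution (uniform_prob (@ltr01 R) \x uniform_cube R d')%E
               (@cons_pair R d')
  end.

Lemma uniform_cube_box (R : realType) (d : nat) (A : 'I_d -> set R) :
  (forall k, measurable (A k)) ->
  uniform_cube R d [set u | forall k, A k (tnth u k)] =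
  (\prod_(k < d) lebesgue_measure (A k `&` `[0%R, 1%R[))%E.
Proof.
elim: d A => [|d IHd] A mA /=.
  rewrite big_ord0 diracE (_ : (_ \in _) = true)//.
  by apply/mem_set => -[].
rewrite big_ord_recl /distribution /pushforward.
rewrite (_ : _ @^-1` _ =
    A ord0 `*` [set u | forall k, A (lift ord0 k) (tnth u k)]); last first.
  apply/seteqP; split=> [[x u]/= Axu|[x u]/= [Ax Au] k].
    split; first by have := Axu ord0; rewrite tnth0.
    by move=> k; have := Axu (lift ord0 k); rewrite tnthS.
  by case: (unliftP ord0 k) => [j|] ->; rewrite ?tnthS ?tnth0//; exact: Au.
rewrite product_measure1E//; last first.
  rewrite (_ : [set _ | _] = \bigcap_(k : 'I_d)
     ((fun u : d.-tuple R => tnth u k) @^-1` A (lift ord0 k))); last first.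
    by apply/seteqP; split=> u /= Au k; [move=> _|]; exact: Au.
  apply: fin_bigcap_measurable => // k _.
  by rewrite -[X in measurable X]setTI; exact: measurable_tnth.
  exact: mA.
congr (_ * _)%E; last by rewrite -IHd.
rewrite [LHS]integral_uniform_pdf.
rewrite (eq_integral (fun=> 1%E)); last first.
  move=> x; rewrite inE/= in_itv/= /uniform_pdf => -[_ ->].
  by rewrite subr0 invr1.
rewrite integral_cst ?mul1e; last first.
  by apply: measurableI; [exact: mA|exact: measurable_itv].
have m01 : measurable (A ord0 `&` `[0%R, 1%R[) by exact: measurableI.
have <- : A ord0 `&` `[0%R, 1%R[ `|` A ord0 `&` [set 1%R] =
          A ord0 `&` `[0%R, 1%R].
  by rewrite -setIUr setUitv1// bnd_simp.
have m1 : measurable (A ord0 `&` [set 1%R]) by exact: measurableI.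
apply: measureU0; [exact: m01|exact: m1|].
apply/eqP; rewrite eq_le measure_ge0 andbT -(lebesgue_measure_set1 (1 : R)).
by apply: le_measure; rewrite ?inE//; exact: m1.
Qed.

(* [X] has law [f * mu]; since [P setT = 1], [f] integrates to 1. *)
Definition has_density d d' (T : measurableType d) (T' : measurableType d')
    (R : realType) (P : probability T R) (mu : {measure set T' -> \bar R})
    (X : T -> T') (f : T' -> R) : Prop :=
  [/\ measurable_fun setT X, measurable_fun setT f, forall x, 0 <= f x &
      forall A, measurable A ->
        P (X @^-1` A) = (\int[mu]_(x in A) (f x)%:E)%E].

Definition independent_pair d d1 d2 (T : measurableType d)
    (T1 : measurableType d1) (T2 : measurableType d2) (R : realType)
    (P : probability T R) (X1 : T -> T1) (X2 : T -> T2) : Prop :=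
  forall A1 A2, measurable A1 -> measurable A2 ->
    P (X1 @^-1` A1 `&` X2 @^-1` A2) = (P (X1 @^-1` A1) * P (X2 @^-1` A2))%E.

Definition mutually_independent d (T : measurableType d) (R : realType)
    (P : probability T R) (I : eqType) (D : set I) (X : I -> T -> R) : Prop :=
  (forall i, D i -> measurable_fun setT (X i)) /\
  forall (J : seq I) (A : I -> set R),
    uniq J -> [set` J] `<=` D -> (forall i, measurable (A i)) ->
    P (\bigcap_(i in [set` J]) X i @^-1` A i) =
    (\prod_(i <- J) P (X i @^-1` A i))%E.

Definition same_law d d' (T : measurableType d) (T' : measurableType d')
    (R : realType) (P : probability T R) (P' : probability T' R)
    (X : T -> R) (X' : T' -> R) : Prop :=
  forall A : set R, measurable A -> P (X @^-1` A) = P' (X' @^-1` A).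

Section inner_simulation.
Context (R : realType) (d : nat) dO (Omega : measurableType dO)
  dS (S : measurableType dS).
Variables (psi : d.-tuple R -> Omega -> R)
  (u : forall m, 'I_m -> {mfun S >-> d.-tuple R}).

Definition inner_mean (y : Omega) : R := \int[uniform_cube R d]_v psi v y.

(* [s] is the randomness of the points: [u m j s] is the [j]-th of the [m]
   points used by the estimator with inner sample size [m]. *)
Definition inner_estimator (m : nat) (y : Omega) (s : S) : R :=
  m%:R^-1 * \sum_(j < m) psi (u j s) y.

End inner_simulation.

Definition level_size (l0 l : nat) : nat := 2 ^ (l + l0).

Section multilevel.
Context (R : realType) (d : nat) dO (Omega : measurableType dO)
  dS (S : measurableType dS) (T : Type).
Variables (psi : d.-tuple R -> Omega -> R)
  (u : forall m, 'I_m -> {mfun S >-> d.-tuple R})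
  (omega : T -> Omega) (Z : T -> S) (c : R) (l0 : nat).

Definition level_indicator (l : nat) (t : T) : R :=
  (c < inner_estimator psi u (level_size l0 l) (omega t) (Z t))%R%:R.

Definition level_term (l : nat) (t : T) : R :=
  if l is l'.+1 then level_indicator l t - level_indicator l' t
  else level_indicator 0 t.

End multilevel.

Definition mlmc_replications d d' (T : measurableType d)
    (T' : measurableType d') (R : realType) (P : probability T R)
    (P' : probability T' R) (Y : nat -> T -> R) (L : nat) (N : nat -> nat)
    (Yrep : nat -> nat -> T' -> R) : Prop :=
  (forall l i, (l <= L)%N -> (i < N l)%N -> same_law P P' (Y l) (Yrep l i)) /\
  mutually_independent P' [set li : nat * nat |
      (li.1 <= L)%N /\ (li.2 < N li.1)%N]
    (fun li => Yrep li.1 li.2).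

Definition mlmc_estimator (T : Type) (R : realType) (L : nat) (N : nat -> nat)
    (Yrep : nat -> nat -> T -> R) (t : T) : R :=
  \sum_(l < L.+1) (N l)%:R^-1 * \sum_(i < N l) Yrep l i t.

Definition mlmc_cost (R : realType) (L : nat) (N : nat -> nat)
    (cost : nat -> R) : R :=
  \sum_(l < L.+1) (N l)%:R * cost l.

Definition mlmc_rate (R : realType) (eta eps : R) : R :=
  if 2 < eta then eps ^- 2
  else if eta == 2 then eps ^- 2 * ln eps ^+ 2
  else eps `^ (- (3 / 2) - eta^-1).

(* Main.v *)
Require Import Defs.
From HB Require Import structures.
From mathcomp Require Import all_boot all_order all_algebra.
From mathcomp Require Import all_classical all_reals all_analysis.
From mathcomp Require Import measurable_realfun ring lra.

Set Implicit Arguments.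
Unset Strict Implicit.
Unset Printing Implicit Defensive.

Import Order.TTheory GRing.Theory Num.Theory.
Import numFieldNormedType.Exports.

Local Open Scope classical_set_scope.
Local Open Scope ring_scope.

(** The estimator has mean P(ghat_L > c), where ghat_L is the inner estimator of
    the finest level, so its mean squared error is a variance, at most the sum
    over the levels of E[Y_l ^ 2] / N_l, plus the squared bias
    (P(ghat_L > c) - theta) ^ 2 ([mlmc_mse]).

    Fix an inner sample size m and put delta = m ^ (- eta / 2), G = g(omega)
    and W = (ghat_m - G) / delta, so that ghat_m > c reads G + delta * W > c.
    For W = y this differs from G > c only when G lies in an interval of length
    delta * |y| with endpoint c.  Two bounds follow from integrating the joint
    density p_m over this window.
    - Bounding p_m by f_0 shows that the two indicators differ with probability
      O(delta) ([threshold_strong_error]).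
    - Replacing p_m(x, y) by p_m(c, y), at the price of the Lipschitz constant
      f_1(y) in x, gives
        P(ghat_m > c) - P(G > c) = delta * int y p_m(c, y) dy + O(delta ^ 2).
      The integral vanishes: given omega, the error W has mean zero, hence
      E[W; c < G <= c + h] = 0 for all h > 0 ([inner_error_mean0]), and the same
      expansion of this expectation as h tends to 0 identifies the integral
      ([density_first_moment0]).  So the bias is O(delta ^ 2)
      ([threshold_weak_error]).

    Hence E[Y_l ^ 2] = O(2 ^ (- eta l / 2)), the bias is O(2 ^ (- eta L)) and a
    sample of level l costs O(2 ^ l).  Taking 2 ^ L of order eps ^ (- 1 / eta)
    and N_l proportional to the square root of variance over cost
    ([mlmc_allocation]) leads to a cost of order
    eps ^ -2 (sum_(l <= L) q ^ l) ^ 2 + 2 ^ L with q = 2 ^ ((1 - eta / 2) / 2);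
    the three rates are the three positions of q with respect to 1
    ([mlmc_rate_bound]). *)

(** * Densities and independence *)

Section densities.
Context d d' (T : measurableType d) (T' : measurableType d') (R : realType).
Variables (P : probability T R) (mu : {measure set T' -> \bar R}).
Hypothesis mu_sigma_finite : sigma_finite setT mu.
Variables (X : T -> T') (f : T' -> R).
Hypothesis Xf : has_density P mu X f.

Let mX : measurable_fun setT X. Proof. by case: Xf. Qed.

Let mu' : set T' -> \bar R := mu.
HB.instance Definition _ := Measure.on mu'.
HB.instance Definition _ :=
  Measure_isSigmaFinite.Build _ _ _ mu' mu_sigma_finite.

(** The density is a version of the Radon-Nikodym derivative of the law of [X],
    whose change of variables formula then applies. *)
Lemma ge0_integral_density (h : T' -> \bar R) :
  measurable_fun [set: T'] h -> (forall x, 0 <= h x)%E ->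
  (\int[P]_t h (X t) = \int[mu]_x (h x * (f x)%:E))%E.
Proof.
case: Xf => _ mf f0 Pf mh h0.
pose X' : {RV P >-> T'} := HB.pack X (isMeasurableFun.Build _ _ _ _ X mX).
pose nu : probability T' R := distribution P X'.
have nuE A : measurable A -> nu A = (\int[mu]_(x in A) (f x)%:E)%E.
  by move=> mA; rewrite -Pf.
have numu : nu `<< mu'.
  apply/null_content_dominatesP => A mA muA0; rewrite nuE//.
  by apply: null_set_integral => //; apply/measurable_EFinP/measurable_funTS.
rewrite -(@ge0_integral_distribution _ _ _ _ _ P X')//.
have -> : (\int[distribution P X']_y h y = \int[nu]_y h y)%E by [].
transitivity (\int[mu']_x (h x * (f x)%:E))%E => //.
rewrite -(Radon_Nikodym_SigmaFinite.change_of_variables numu)//.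
have iRN := Radon_Nikodym_SigmaFinite.f_integrable numu.
apply: ae_eq_integral => //.
- by apply: emeasurable_funM => //; exact: measurable_int iRN.
- by apply: emeasurable_funM => //; exact/measurable_EFinP.
apply: ae_eqe_mul2l; apply: integral_ae_eq => //.
  exact/measurable_EFinP.
by move=> E _ mE; rewrite -nuE// -Radon_Nikodym_SigmaFinite.f_integral.
Qed.

Lemma integrable_density (h : T' -> R) : measurable_fun [set: T'] h ->
  mu.-integrable setT (fun x => (h x * f x)%:E) ->
  P.-integrable setT (fun t => (h (X t))%:E).
Proof.
case: Xf => _ mf f0 _ mh /integrableP[_ hfoo]; apply/integrableP; split.
  by apply/measurable_EFinP; exact: measurableT_comp mX.
rewrite (ge0_integral_density (h := fun x => `|(h x)%:E|%E))//; last first.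
  by apply: measurableT_comp => //; exact/measurable_EFinP.
rewrite (eq_integral (fun x => `|(h x * f x)%:E|%E))// => x _.
by rewrite /= normrM (ger0_norm (f0 x)) EFinM.
Qed.

Lemma integral_density (h : T' -> R) : measurable_fun [set: T'] h ->
  mu.-integrable setT (fun x => (h x * f x)%:E) ->
  (\int[P]_t (h (X t))%:E = \int[mu]_x (h x * f x)%:E)%E.
Proof.
case: (Xf) => _ mf f0 _ mh ih.
rewrite [LHS]integralE [RHS]integralE.
have mh' : measurable_fun setT (EFin \o h) by exact/measurable_EFinP.
congr (_ - _)%E.
- transitivity (\int[P]_t ((EFin \o h)^\+ (X t)))%E.
    by apply: eq_integral => t _; rewrite !funeposE.
  rewrite ge0_integral_density//; last exact: measurable_funepos.
  apply: eq_integral => x _; rewrite !funeposE/=.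
  by rewrite -!EFin_max -EFinM maxr_pMl// mul0r.
- transitivity (\int[P]_t ((EFin \o h)^\- (X t)))%E.
    by apply: eq_integral => t _; rewrite !funenegE.
  rewrite ge0_integral_density//; last exact: measurable_funeneg.
  apply: eq_integral => x _; rewrite !funenegE/=.
  by rewrite -!EFin_max -EFinM maxr_pMl// mul0r mulNr.
Qed.

End densities.

Section independence.
Context d d1 d2 (T : measurableType d) (T1 : measurableType d1)
  (T2 : measurableType d2) (R : realType) (P : probability T R).
Variables (X1 : {RV P >-> T1}) (X2 : {RV P >-> T2}).
Hypothesis X12 : independent_pair P X1 X2.

Let X (t : T) := (X1 t, X2 t).

Let mX : measurable_fun setT X.
Proof. exact: measurable_fun_pair. Qed.

Let X' : {RV P >-> (T1 * T2)%type} :=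
  HB.pack X (isMeasurableFun.Build _ _ _ _ X mX).

(** Both sides agree on rectangles, which determine a product measure. *)
Lemma independent_pair_law A : measurable A ->
  P (X @^-1` A) = (distribution P X1 \x distribution P X2)%E A.
Proof.
move=> mA; apply/esym/(@product_measure_unique _ _ _ _ _
  (distribution P X1) (distribution P X2) (distribution P X')) => //.
Qed.

(** Freezing the first variable: this is how the independence of the scenario
    and the inner randomness turns into a conditional expectation. *)
Lemma independent_pair_fubini (F : T1 * T2 -> R) : measurable_fun setT F ->
  P.-integrable setT (fun t => (F (X1 t, X2 t))%:E) ->
  (\int[P]_t (F (X1 t, X2 t))%:E =
   \int[distribution P X1]_x \int[distribution P X2]_y (F (x, y))%:E)%E.
Proof.
move=> mF iF; have mF' := (measurable_EFinP _ _).2 mF.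
transitivity (\int[distribution P X']_z (F z)%:E)%E.
  by rewrite integral_distribution.
have iF' : (distribution P X').-integrable setT (EFin \o F).
  exact: integrable_pushforward.
have lawE A : measurable A -> A `<=` setT ->
    distribution P X' A = (distribution P X1 \x distribution P X2)%E A.
  by move=> mA _; exact: independent_pair_law.
rewrite (eq_measure_integral _ lawE).
rewrite -(@integral12_prod_meas1 _ _ _ _ _ (distribution P X1) (distribution P X2) (EFin \o F))//.
apply/integrableP; split => //.
rewrite -(eq_measure_integral _ lawE).
by case/integrableP : iF'.
Qed.

End independence.

Lemma expectation_mul_independent d (T : measurableType d) (R : realType)
    (P : probability T R) (X1 X2 : {RV P >-> R}) :
  independent_pair P X1 X2 ->
  P.-integrable setT (EFin \o X1) -> P.-integrable setT (EFin \o X2) ->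
  P.-integrable setT (EFin \o (X1 \* X2)%R) ->
  ('E_P[(X1 \* X2)%R] = 'E_P[X1] * 'E_P[X2])%E.
Proof.
move=> X12 i1 i2 i12; rewrite !unlock.
have m0 : measurable_fun setT (fun x : R * R => x.1 * x.2).
  by apply: measurable_funM; [exact: measurable_fst|exact: measurable_snd].
rewrite (independent_pair_fubini X12 m0)//=.
under eq_integral.
  move=> x _; under eq_integral do rewrite EFinM.
  rewrite integralZl//; last first.
    by apply: integrable_pushforward.
  over.
rewrite /= -(@integral_distribution _ _ _ _ _ P X2 EFin)//.
rewrite -(@integral_distribution _ _ _ _ _ P X1 EFin)//.
have fE : (\int[distribution P X2]_y y%:E)%E \is a fin_num.
  by apply: integrable_fin_num => //; apply: integrable_pushforward.
rewrite -(fineK fE) integralZr//.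
by apply: integrable_pushforward.
Qed.

(** * Kernels supported in a window around a point *)

Section windows.
Context (R : realType).
Local Notation lambda := (@lebesgue_measure R).
Local Notation lambda2 := (lambda \x lambda)%E.
Variables (c : R) (rad : R -> R).
Hypotheses (mrad : measurable_fun setT rad) (rad0 : forall y, 0 <= rad y).

(** The section of this set at height [y] is the interval of radius [rad y]
    around [c]. *)
Definition window : set (R * R) := [set z | `|z.1 - c| <= rad z.2].

Lemma measurable_window : measurable window.
Proof.
rewrite (_ : window = (fun z => rad z.2 - `|z.1 - c|) @^-1` `[0, +oo[); last first.
  by apply/seteqP; split=> z /=; rewrite in_itv/= andbT subr_ge0.
rewrite -[X in measurable X]setTI.
suff mz : measurable_fun setT (fun z : R * R => rad z.2 - `|z.1 - c|).
  by apply: mz.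
apply: measurable_funB.
  by apply: (measurableT_comp mrad); exact: measurable_snd.
apply: measurableT_comp => //.
by apply: measurable_funB => //; exact: measurable_fst.
Qed.

Let indic_window x y : \1_window (x, y) = \1_`[c - rad y, c + rad y] x :> R.
Proof.
rewrite !indicE; congr (nat_of_bool _)%:R.
by apply/idP/idP; rewrite !inE/= in_itv/= /window/= ler_distl lerBlDr.
Qed.

Let lebesgue_measure_window y :
  lambda `[c - rad y, c + rad y] = (2 * rad y)%:E.
Proof.
rewrite lebesgue_measure_itv/= lte_fin.
case: ltP => cr; last first.
  have -> : rad y = 0 by apply/eqP; rewrite eq_le rad0 andbT; lra.
  by rewrite mulr0.
by rewrite -EFinD; congr _%:E; ring.
Qed.

(** Tonelli, the section at [y] having length [2 * rad y]. *)
Lemma integral_window (v : R -> R) : measurable_fun setT v ->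
  (forall y, 0 <= v y) ->
  (\int[lambda2]_z (v z.2 * \1_window z)%:E =
   \int[lambda]_y (2 * (rad y * v y))%:E)%E.
Proof.
move=> mv v0.
have mvw : measurable_fun setT (fun z : R * R => v z.2 * \1_window z).
  apply: measurable_funM.
    by apply: (measurableT_comp mv); exact: measurable_snd.
  apply: measurable_indic; exact: measurable_window.
rewrite fubini_tonelli2//=; first last.
- by move=> z; rewrite lee_fin mulr_ge0.
- exact/measurable_EFinP.
apply: eq_integral => y _; rewrite /fubini_G/=.
transitivity (\int[lambda]_x ((v y)%:E * (\1_`[c - rad y, c + rad y] x)%:E))%E.
  by apply: eq_integral => x _; rewrite -EFinM indic_window.
rewrite ge0_integralZl ?lee_fin//; last first.
  by apply/measurable_EFinP; exact: measurable_indic.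
rewrite integral_indic// setIT.
by rewrite [X in (_ * X)%E]lebesgue_measure_window -EFinM; congr _%:E; ring.
Qed.

Lemma integral_abs_window (g : R * R -> R) (v : R -> R) :
  measurable_fun setT g -> measurable_fun setT v ->
  (forall z, `|g z| <= v z.2 * \1_window z) -> (forall y, 0 <= v y) ->
  (\int[lambda2]_z `|(g z)%:E| <= \int[lambda]_y (2 * (rad y * v y))%:E)%E.
Proof.
move=> mg mv gv v0; rewrite -integral_window//.
apply: ge0_le_integral => //.
- by apply: measurableT_comp => //; exact/measurable_EFinP.
- apply/measurable_EFinP/measurable_funM.
    by apply: (measurableT_comp mv); exact: measurable_snd.
  apply: measurable_indic; exact: measurable_window.
by move=> z _; rewrite /= lee_fin.
Qed.

Lemma integrable_window (g : R * R -> R) (v : R -> R) :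
  measurable_fun setT g -> measurable_fun setT v ->
  (forall z, `|g z| <= v z.2 * \1_window z) -> (forall y, 0 <= v y) ->
  (\int[lambda]_y (2 * (rad y * v y))%:E < +oo)%E ->
  lambda2.-integrable setT (EFin \o g).
Proof.
move=> mg mv gv v0 voo; apply/integrableP; split.
  exact/measurable_EFinP.
by apply: le_lt_trans voo; exact: integral_abs_window.
Qed.

Section expansion.
Variables (p : R -> R -> R) (f0 f1 : R -> R).
Hypotheses (mp : measurable_fun setT (fun z : R * R => p z.1 z.2))
  (mf0 : measurable_fun setT f0) (mf1 : measurable_fun setT f1).
Hypotheses (pf0 : forall x y, `|p x y| <= f0 y)
  (pf1 : forall x y, `|p x y - p c y| <= f1 y * `|x - c|).
Variables (k : R * R -> R) (w : R -> R).
Hypotheses (mk : measurable_fun setT k) (mw : measurable_fun setT w)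
  (w0 : forall y, 0 <= w y) (kw : forall z, `|k z| <= w z.2 * \1_window z).

Let f0_ge0 y : 0 <= f0 y. Proof. exact: le_trans (pf0 0 y). Qed.

Let f1_ge0 y : 0 <= f1 y.
Proof.
by have := le_trans (normr_ge0 _) (pf1 (c + 1) y); rewrite addrC addKr normr1 mulr1.
Qed.

Let mpc : measurable_fun setT (p c).
Proof. exact: (measurableT_comp mp (pair1_measurable c)). Qed.

Let mkp : measurable_fun setT (fun z => k z * p z.1 z.2).
Proof. exact: measurable_funM. Qed.

Let mkpc : measurable_fun setT (fun z => k z * p c z.2).
Proof.
by apply: measurable_funM => //; apply: (measurableT_comp mpc); exact: measurable_snd.
Qed.

Let bound0 (q : R * R -> R) : (forall z, `|q z| <= f0 z.2) ->
  forall z, `|k z * q z| <= (w z.2 * f0 z.2) * \1_window z.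
Proof.
by move=> qf z; rewrite normrM mulrAC ler_pM.
Qed.

Let mwf0 : measurable_fun setT (fun y => w y * f0 y).
Proof. exact: measurable_funM. Qed.

Let wf0_ge0 y : 0 <= w y * f0 y. Proof. exact: mulr_ge0. Qed.

Lemma abs_kernel_density :
  (\int[lambda2]_z `|(k z * p z.1 z.2)%:E| <=
   \int[lambda]_y (2 * (rad y * (w y * f0 y)))%:E)%E.
Proof. exact: (integral_abs_window mkp mwf0 (bound0 (fun z => pf0 z.1 z.2))). Qed.

Hypothesis f0oo : (\int[lambda]_y (2 * (rad y * (w y * f0 y)))%:E < +oo)%E.

Lemma integrable_kernel_density :
  lambda2.-integrable setT (fun z => (k z * p z.1 z.2)%:E).
Proof. exact: (integrable_window mkp mwf0 (bound0 (fun z => pf0 z.1 z.2))). Qed.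

(** Inside the window [p x y] differs from [p c y] by at most [f1 y * rad y],
    and the window at height [y] has length [2 * rad y].  What remains after this
    replacement factors, the integral of [k] in its first variable being
    [kappa]. *)
Lemma kernel_density_expansion (kappa : R -> R) (e : R) :
  (forall y, \int[lambda]_x (k (x, y))%:E = (kappa y)%:E)%E ->
  (\int[lambda]_y (2 * (rad y * (w y * rad y * f1 y)))%:E <= e%:E)%E ->
  lambda.-integrable setT (fun y => (kappa y * p c y)%:E) /\
  `| \int[lambda2]_z (k z * p z.1 z.2) - \int[lambda]_y (kappa y * p c y) |
    <= e.
Proof.
move=> kkappa ke.
have ikp := integrable_kernel_density.
have ikpc : lambda2.-integrable setT (fun z => (k z * p c z.2)%:E).
  exact: (integrable_window mkpc mwf0 (bound0 (fun z => pf0 c z.2))).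
have mkx y : measurable_fun setT (fun x => k (x, y)).
  exact: (measurableT_comp mk (pair2_measurable y)).
have kx y : (\int[lambda]_x `|(k (x, y))%:E| <= (2 * (rad y * w y))%:E)%E.
  apply: (@le_trans _ _ (\int[lambda]_x ((w y)%:E * (\1_`[c - rad y, c + rad y] x)%:E))%E).
    apply: ge0_le_integral => //.
    - by apply/measurable_EFinP; exact: measurableT_comp (mkx y).
    - by apply/measurable_EFinP; apply: measurable_funM.
    move=> x _; rewrite -EFinM lee_fin; apply: (le_trans (kw _)) => /=.
    by rewrite indic_window.
  rewrite ge0_integralZl ?lee_fin//; last first.
  by apply/measurable_EFinP; exact: measurable_indic.
rewrite integral_indic// setIT.
  by rewrite [X in (_ * X)%E]lebesgue_measure_window -EFinM lee_fin mulrA mulrC [_ * rad y]mulrC.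
have ikx y : lambda.-integrable setT (fun x => (k (x, y))%:E).
  apply/integrableP; split; first by apply/measurable_EFinP; exact: mkx.
  exact: le_lt_trans (kx y) (ltry _).
have innerE y : fubini_G lambda (fun z => (k z * p c z.2)%:E) y = (kappa y * p c y)%:E.
  rewrite /fubini_G/=; under eq_integral do rewrite EFinM.
  by rewrite integralZr// kkappa -EFinM.
have outerE := integral21_prod_meas1 ikpc.
split.
  have ib : lambda.-integrable setT (fun y => (2 * (rad y * (w y * f0 y)))%:E).
    apply/integrableP; split.
      by apply/measurable_EFinP; do 2 apply: measurable_funM => //.
    apply: le_lt_trans f0oo; rewrite le_eqVlt; apply/orP; left; apply/eqP.
    by apply: eq_integral => y _; rewrite gee0_abs// lee_fin !mulr_ge0.
  apply: (le_integrable _ _ _ ib) => //.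
  - rewrite -(funext innerE); exact: measurable_fubini_G ikpc.
  - move=> y _; rewrite /= lee_fin normrM [leRHS]ger0_norm; last by rewrite !mulr_ge0.
    rewrite !mulrA ler_pM// -lee_fin -mulrA -abse_EFin -kkappa.
    apply: le_trans (kx y).
    by apply: le_abse_integral => //; apply/measurable_EFinP; exact: mkx.
rewrite [X in _ - X](_ : _ = \int[lambda2]_z (k z * p c z.2)); last first.
  rewrite /Rintegral -outerE; congr fine; apply: eq_integral => y _.
  exact/esym/innerE.
rewrite -RintegralB//.
have idiff : lambda2.-integrable setT (fun z => (k z * p z.1 z.2 - k z * p c z.2)%:E).
  by under eq_fun do rewrite EFinB; exact: integrableB.
apply: le_trans (le_normr_Rintegral _ idiff) _ => //.
rewrite /Rintegral -lee_fin fineK; last first.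
  apply: integrable_fin_num => //.
  by under eq_fun do rewrite -abse_EFin; exact: integrable_abse.
apply: le_trans ke.
apply: (@integral_abs_window _ (fun y => w y * rad y * f1 y)).
- by apply: measurable_funB.
- by apply: measurable_funM => //; apply: measurable_funM.
- move=> z; rewrite -mulrBr normrM.
  apply: (le_trans (ler_pM _ _ (kw z) (pf1 z.1 z.2))) => //.
  rewrite indicE; case: (boolP (z \in window)) => zw; last by rewrite !mulr0 mul0r.
  rewrite !mulr1 -mulrA ler_wpM2l// mulrC ler_wpM2r//.
  by move: zw; rewrite inE.
- by move=> y; rewrite !mulr_ge0.
Qed.

End expansion.
End windows.

(** * Crossing the threshold *)

Lemma bounded_derivative_increment (R : realType) (F : R -> R) (M a b : R) :
  (forall x, derivable F x 1) -> (forall x, `|derive1 F x| <= M) ->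
  `|F b - F a| <= M * `|b - a|.
Proof.
move=> dF FM.
wlog ab : a b / a <= b.
  by move=> H; have [/H//|/ltW/H] := leP a b; rewrite distrC [X in _ <= _ * X -> _]distrC.
have [||x _ ->] := @MVT_segment _ F (derive1 F) a b ab.
- by move=> x _; apply: DeriveDef => //; rewrite derive1E.
- apply: derivable_within_continuous => x _; exact: dF.
by rewrite normrM ler_wpM2r.
Qed.

Lemma integral_indic_itvoc (R : realType) (a b : R) : a <= b ->
  (\int[lebesgue_measure]_x (\1_`]a, b] x)%:E = (b - a)%:E)%E.
Proof.
move=> ab; rewrite integral_indic// setIT.
transitivity (lebesgue_measure (`]a, b]%classic : set R)) => //.
rewrite lebesgue_measure_itv/= lte_fin; case: ltP => // ba.
by rewrite (_ : b = a) ?subrr//; apply/eqP; rewrite eq_le ab ba.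
Qed.

Lemma sigma_finite_product d1 d2 (T1 : measurableType d1)
    (T2 : measurableType d2) (R : realType)
    (m1 : {sigma_finite_measure set T1 -> \bar R})
    (m2 : {sigma_finite_measure set T2 -> \bar R}) :
  sigma_finite setT (m1 \x m2)%E.
Proof.
have /sigma_finiteP[F [TF ndF Foo]] := sigma_finiteT m1.
have /sigma_finiteP[G [TG ndG Goo]] := sigma_finiteT m2.
exists (fun n => F n `*` G n).
  rewrite -setXTT TF TG; apply/seteqP; split=> -[x y]/=.
    move=> [[n _ Fnx] [k _ Gky]]; exists (maxn n k) => //; split.
      by move: x Fnx; exact/subsetPset/ndF/leq_maxl.
    by move: y Gky; exact/subsetPset/ndG/leq_maxr.
  by move=> [n _ [? ?]]; split; exists n.
move=> k; have [mF Fk] := Foo k; have [mG Gk] := Goo k.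
split; first exact: measurableX.
by rewrite product_measure1E// lte_mul_pinfty// ge0_fin_numE.
Qed.
Lemma sigma_finite_lebesgue2 (R : realType) :
  sigma_finite setT (@lebesgue_measure R \x @lebesgue_measure R)%E.
Proof. exact: sigma_finite_product. Qed.

Section threshold.
Context d (T : measurableType d) (R : realType) (P : probability T R).
Local Notation lambda := (@lebesgue_measure R).
Local Notation lambda2 := (lambda \x lambda)%E.
Variables (G W : T -> R) (c : R) (p : R -> R -> R) (f0 f1 : R -> R) (B : R).
Hypothesis GWp : has_density P lambda2 (fun t => (G t, W t))
  (fun z => p z.1 z.2).
Hypotheses (mf0 : measurable_fun setT f0) (mf1 : measurable_fun setT f1).
Hypotheses (pf0 : forall x y, `|p x y| <= f0 y)
  (pf1 : forall x y, `|p x y - p c y| <= f1 y * `|x - c|).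
Hypotheses (f0B : (\int[lambda]_y (`|y| * f0 y)%:E <= B%:E)%E)
  (f1B : (\int[lambda]_y (`|y| * f1 y)%:E <= B%:E)%E)
  (f1B2 : (\int[lambda]_y (`|y| ^+ 2 * f1 y)%:E <= B%:E)%E).

Let mp : measurable_fun setT (fun z : R * R => p z.1 z.2).
Proof. by case: GWp. Qed.

Let mabs : measurable_fun setT (fun y : R => `|y|).
Proof. exact: normr_measurable. Qed.

Let f0_ge0 y : 0 <= f0 y. Proof. exact: le_trans (pf0 0 y). Qed.

Let f1_ge0 y : 0 <= f1 y.
Proof.
by have := le_trans (normr_ge0 _) (pf1 (c + 1) y); rewrite addrC addKr normr1 mulr1.
Qed.

Let integral_scale (a : R) (g h : R -> R) : 0 <= a ->
  measurable_fun setT g -> (forall y, 0 <= g y) ->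
  (\int[lambda]_y (g y)%:E <= B%:E)%E -> (forall y, h y = a * g y) ->
  (\int[lambda]_y (h y)%:E <= (a * B)%:E)%E.
Proof.
move=> a0 mg g0 gB hE; under eq_integral do rewrite hE EFinM.
rewrite ge0_integralZl//.
- by rewrite EFinM lee_wpmul2l// lee_fin.
- exact/measurable_EFinP.
- by move=> y _; rewrite lee_fin.
Qed.

(* This kernel records the second variable when the first one is in ]c, c + h];
   its integral in the first variable is h times the second variable. *)
Let strip (h : R) (z : R * R) : R := z.2 * \1_`]c, c + h] z.1.

Let mstrip h : measurable_fun setT (strip h).
Proof.
apply: measurable_funM; first exact: measurable_snd.
by apply: (measurableT_comp (measurable_indic _)) => //; exact: measurable_fst.
Qed.

Let strip_window h z : 0 < h ->
  `|strip h z| <= `|z.2| * \1_(window c (cst h)) z.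
Proof.
move=> h0; rewrite /strip normrM ler_wpM2l// !indicE ger0_norm// ler_nat.
case: (boolP (z.1 \in _)) => //; rewrite inE/= in_itv/= => /andP[cz zh].
by rewrite mem_set// /window/= ger0_norm; lra.
Qed.

Let integral_strip h y : 0 < h ->
  (\int[lambda]_x (strip h (x, y))%:E = (h * y)%:E)%E.
Proof.
move=> h0; rewrite /strip/=; under eq_integral do rewrite EFinM.
rewrite integralZl//; last exact: integrable_indic_itv.
by rewrite integral_indic_itvoc ?lerDl ?ltW// -EFinM; congr _%:E; ring.
Qed.

Let abs_window_f0 h : 0 < h ->
  (\int[lambda]_y (2 * (cst h y * (`|y| * f0 y)))%:E <= (2 * h * B)%:E)%E.
Proof.
move=> h0; apply: integral_scale f0B _ => //=.
- by rewrite mulr_ge0// ltW.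
- exact: measurable_funM.
- by move=> y; rewrite mulr_ge0.
- by move=> y; rewrite !mulrA.
Qed.

Let integrable_strip_density h : 0 < h ->
  lambda2.-integrable setT (fun z => (strip h z * p z.1 z.2)%:E).
Proof.
move=> h0; apply: (@integrable_kernel_density _ c (cst h) _ _ p f0 mp mf0 pf0
  (strip h) (fun y => `|y|)) => //.
- by move=> y; exact: ltW.
- by move=> z; exact: strip_window.
- exact: le_lt_trans (abs_window_f0 h0) (ltry _).
Qed.

Lemma integrable_strip h : 0 < h ->
  P.-integrable setT (fun t => (W t * \1_`]c, c + h] (G t))%:E).
Proof.
move=> h0; exact: (integrable_density (@sigma_finite_lebesgue2 R) GWp (mstrip h)
  (integrable_strip_density h0)).
Qed.

Hypothesis mean0 : forall h, 0 < h ->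
  (\int[P]_t (W t * \1_`]c, c + h] (G t))%:E = 0)%E.

(** The strips [c < G <= c + h] give [h * phi = O(h ^ 2)] for the integral [phi]
    in question. *)
Lemma density_first_moment0 : \int[lambda]_y (y * p c y) = 0.
Proof.
set phi := (LHS).
have B0 : 0 <= B.
  by rewrite -lee_fin; apply: le_trans f0B; apply: integral_ge0 => y _;
    rewrite lee_fin mulr_ge0.
suff phiB h : 0 < h -> `|phi| <= 2 * h * B.
  apply/eqP; rewrite -normr_le0; apply/ler_addgt0Pl => e e0; rewrite addr0.
  have B1 : 0 < 2 * B + 1 by rewrite ltr_wpDl// mulr_ge0.
  (* With this choice of h the bound 2 h B stays below e, even when B = 0. *)
  have h0 : 0 < e / (2 * B + 1) by rewrite divr_gt0.
  apply: le_trans (phiB _ h0) _.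
  have he : e / (2 * B + 1) * (2 * B + 1) = e by rewrite divfK// gt_eqF.
  by move: (e / _) h0 he => h h0 he; nra.
move=> h0.
have mh : measurable_fun setT (cst h : R -> R) by exact: measurable_cst.
have hh (y : R) : 0 <= cst h y by exact: ltW.
have kw z := strip_window z h0.
have b0 := le_lt_trans (abs_window_f0 h0) (ltry _).
have ik := integrable_strip_density h0.
have e0 : (\int[lambda]_y (2 * (cst h y * (`|y| * cst h y * f1 y)))%:E <=
    (2 * h ^+ 2 * B)%:E)%E.
  apply: integral_scale f1B _ => //=.
  - by rewrite mulr_ge0// sqr_ge0.
  - exact: measurable_funM.
  - by move=> y; rewrite mulr_ge0.
  - by move=> y; ring.
have [ihp] := kernel_density_expansion mh hh mp mf0 mf1 pf0 pf1 (mstrip h) mabs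
  (fun y => normr_ge0 y) kw b0 (fun y => integral_strip y h0) e0.
have strip0 : \int[lambda2]_z (strip h z * p z.1 z.2) = 0.
  have E := integral_density (@sigma_finite_lebesgue2 R) GWp (mstrip h) ik.
  by rewrite /Rintegral -E mean0.
rewrite strip0 sub0r normrN => le_h.
have iyp : lambda.-integrable setT (fun y => (y * p c y)%:E).
  apply: eq_integrable (integrableZl _ h^-1 ihp) => // y _.
  by rewrite -EFinM !mulrA mulVf ?mul1r// gt_eqF.
move: le_h; under eq_Rintegral do rewrite -mulrA.
rewrite RintegralZl// normrM gtr0_norm// => le_h; rewrite -(ler_pM2l h0).
by apply: le_trans le_h _; rewrite le_eqVlt; apply/orP; left; apply/eqP; ring.
Qed.

Variable delta : R.
Hypothesis delta_gt0 : 0 < delta.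

(** At the pair of the inner mean and the scaled error, this is the indicator
    that the estimator exceeds [c] minus the indicator that the inner mean
    does. *)
Definition jump (z : R * R) : R :=
  (c < z.1 + delta * z.2)%R%:R - (c < z.1)%R%:R.

Let rad (y : R) := delta * `|y|.

Let mrad : measurable_fun setT rad.
Proof. exact: measurable_funM. Qed.

Let rad0 y : 0 <= rad y. Proof. by rewrite mulr_ge0// ltW. Qed.

Let measurable_above (h : R * R -> R) : measurable_fun setT h ->
  measurable_fun setT (fun z => (c < h z)%R%:R : R).
Proof.
move=> mh; rewrite (_ : (fun z => _) = \1_(h @^-1` `]c, +oo[)).
  apply: measurable_indic; rewrite -[X in measurable X]setTI; exact: mh.
apply/funext => z; rewrite indicE; congr (nat_of_bool _)%:R.
by apply/idP/idP; rewrite inE/= in_itv/= andbT.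
Qed.

Let mjump : measurable_fun setT jump.
Proof.
apply: measurable_funB; apply: measurable_above; last exact: measurable_fst.
apply: measurable_funD; first exact: measurable_fst.
by apply: measurable_funM => //; exact: measurable_snd.
Qed.

Let jump_window z : `|jump z| <= cst 1 z.2 * \1_(window c rad) z.
Proof.
rewrite /jump mul1r indicE; case: (boolP (z \in _)) => /= [_|].
  by do 2 case: (c < _) => /=; rewrite ?subrr ?subr0 ?sub0r ?normrN ?normr0 ?normr1.
rewrite notin_setE/= /window/= => /negP; rewrite -ltNge.
have : `|delta * z.2| = rad z.2 by rewrite normrM gtr0_norm.
move: (delta * z.2) => e <- ce.
rewrite (_ : (c < z.1 + e) = (c < z.1)) ?subrr ?normr0//.
by apply/idP/idP; move: ce; case: (ger0P e); case: (ger0P (z.1 - c)); lra.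
Qed.

(* The jump is the signed indicator of the interval between c - delta * y
   and c. *)
Let integral_jump y : (\int[lambda]_x (jump (x, y))%:E = (delta * y)%:E)%E.
Proof.
rewrite /jump/=; move: (delta * y) => e.
have [e0|e0] := leP 0 e.
  rewrite -[in RHS](subKr c e) -integral_indic_itvoc ?gerBl//.
  apply: eq_integral => x _; rewrite indicE mem_setE in_itv/= ltrBlDr leNgt.
  have : c < x -> c < x + e by move=> cx; rewrite ltr_wpDr.
  by case: (c < x); case: (c < x + e); rewrite ?subrr ?subr0//= => /(_ isT).
have -> : e%:E = (- ((c - e) - c)%:E)%E by rewrite -EFinN; congr _%:E; ring.
rewrite -integral_indic_itvoc; last by rewrite lerBrDr gerDl ltW.
rewrite -integral_ge0N//.
apply: eq_integral => x _; apply: (congr1 EFin).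
rewrite indicE mem_setE in_itv/= lerBrDr leNgt.
have : c < x + e -> c < x by move=> cx; rewrite (lt_trans cx)// gtrDl.
by case: (c < x); case: (c < x + e); rewrite ?subrr ?oppr0 ?sub0r//= => /(_ isT).
Qed.

Let jump_f0 :
  (\int[lambda]_y (2 * (rad y * (cst 1%R y * f0 y)))%:E <= (2 * delta * B)%:E)%E.
Proof.
apply: integral_scale f0B _ => /=.
- by rewrite mulr_ge0// ltW.
- exact: measurable_funM.
- by move=> y; rewrite mulr_ge0.
- by move=> y; rewrite /rad; ring.
Qed.

(** The jump is supported in the window of radius [delta * |y|], where the
    density is at most [f0]. *)
Lemma threshold_strong_error :
  (\int[P]_t `|(jump (G t, W t))%:E| <= (2 * delta * B)%:E)%E.
Proof.
apply: le_trans jump_f0.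
have m1 : measurable_fun setT (cst 1 : R -> R) by exact: measurable_cst.
apply: le_trans (abs_kernel_density mrad rad0 mp mf0 pf0 mjump m1
  (fun=> ler01) jump_window).
rewrite (ge0_integral_density (@sigma_finite_lebesgue2 R) GWp (h := fun z => `|(jump z)%:E|%E))//.
  apply: ge0_le_integral => //.
  - move=> z _; rewrite mule_ge0// lee_fin; by case: GWp.
  - apply: emeasurable_funM; last exact/measurable_EFinP.
    by apply: measurableT_comp => //; exact/measurable_EFinP.
  - apply: measurableT_comp => //; apply/measurable_EFinP; exact: measurable_funM.
  - move=> z _; rewrite EFinM abseM lee_wpmul2l//= lee_fin ler_norm//.
by apply: measurableT_comp => //; exact/measurable_EFinP.
Qed.

(** The jump integrates to [delta * y] in its first variable, so the first-order
    term is [delta] times the moment that vanishes by [density_first_moment0]. *)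
Lemma threshold_weak_error :
  `| \int[P]_t (jump (G t, W t)) | <= 2 * delta ^+ 2 * B.
Proof.
have m1 : measurable_fun setT (cst 1 : R -> R) by exact: measurable_cst.
have b0 := le_lt_trans jump_f0 (ltry _).
have e0 : (\int[lambda]_y (2 * (rad y * (cst 1%R y * rad y * f1 y)))%:E <=
    (2 * delta ^+ 2 * B)%:E)%E.
  apply: integral_scale f1B2 _ => /=.
  - by rewrite mulr_ge0// sqr_ge0.
  - by apply: measurable_funM => //; exact: measurable_funX.
  - by move=> y; rewrite mulr_ge0// sqr_ge0.
  - by move=> y; rewrite /rad; ring.
have [ihp] := kernel_density_expansion mrad rad0 mp mf0 mf1 pf0 pf1 mjump m1
  (fun=> ler01) jump_window b0 integral_jump e0.
have ikp := integrable_kernel_density mrad rad0 mp mf0 pf0 mjump m1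
  (fun=> ler01) jump_window b0.
have -> : \int[lambda2]_z (jump z * p z.1 z.2) = \int[P]_t jump (G t, W t).
  have E := integral_density (@sigma_finite_lebesgue2 R) GWp mjump ikp.
  by rewrite /Rintegral -E.
under [X in _ - X]eq_Rintegral do rewrite -mulrA.
rewrite RintegralZl//; last first.
  apply: eq_integrable (integrableZl _ delta^-1 ihp) => // y _.
  by rewrite -EFinM !mulrA mulVf ?mul1r// gt_eqF.
by rewrite density_first_moment0 mulr0 subr0.
Qed.

End threshold.

(** * The inner estimator *)

Section inner_estimator.
Context (R : realType) (d : nat) dT (T : measurableType dT)
  (P : probability T R) dO (Omega : measurableType dO) dS (S : measurableType dS).
Variables (omega : {RV P >-> Omega}) (Z : {RV P >-> S}).
Hypothesis omega_Z_indep : independent_pair P omega Z.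
Variable psi : d.-tuple R -> Omega -> R.
Hypothesis psi_meas : measurable_fun [set: d.-tuple R * Omega]
  (fun vy => psi vy.1 vy.2).
Hypothesis psi_int : forall y,
  (uniform_cube R d).-integrable setT (fun v => (psi v y)%:E).
Variable u : forall m, 'I_m -> {mfun S >-> d.-tuple R}.
Hypothesis u_unif : forall m (j : 'I_m) A, measurable A ->
  P [set t | A (u j (Z t))] = uniform_cube R d A.

Let D := distribution P Z.

Let mpsi y : measurable_fun setT (psi ^~ y).
Proof. exact: (measurableT_comp psi_meas (pair2_measurable y)). Qed.

Lemma measurable_inner_mean : measurable_fun setT (inner_mean psi).
Proof.
have mpsi' := (measurable_EFinP _ _).2 psi_meas.
apply: measurableT_comp => //.
under eq_fun do rewrite integralE.
pose q (vy : d.-tuple R * Omega) := (psi vy.1 vy.2)%:E.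
apply: emeasurable_funB.
- rewrite (_ : (fun y => _) = fubini_G (uniform_cube R d) (q^\+)%E).
    by apply: measurable_fun_fubini_tonelli_G => //; exact: measurable_funepos.
  by apply/funext => y; apply: eq_integral => v _; rewrite !funeposE.
- rewrite (_ : (fun y => _) = fubini_G (uniform_cube R d) (q^\-)%E).
    by apply: measurable_fun_fubini_tonelli_G => //; exact: measurable_funeneg.
  by apply/funext => y; apply: eq_integral => v _; rewrite !funenegE.
Qed.

Lemma measurable_inner_estimator m :
  measurable_fun setT (fun ys : Omega * S => inner_estimator psi u m ys.1 ys.2).
Proof.
apply: measurable_funM => //; apply: measurable_sum => j.
have mj : measurable_fun setT (fun ys : Omega * S => (u j ys.2, ys.1)).
  apply: measurable_fun_pair; last exact: measurable_fst.
  by apply: measurableT_comp => //; exact: measurable_snd.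
exact: (measurableT_comp psi_meas mj).
Qed.

Let law_point m (j : 'I_m) A : measurable A -> A `<=` setT ->
  pushforward D (u j) A = uniform_cube R d A.
Proof. by move=> mA _; rewrite -(u_unif j mA). Qed.

Lemma integrable_point m (j : 'I_m) y :
  D.-integrable setT (fun s => (psi (u j s) y)%:E).
Proof.
apply/integrableP; split.
  by apply/measurable_EFinP; exact: (measurableT_comp (mpsi y)).
have /integrableP[_] := psi_int y.
rewrite -(eq_measure_integral _ (law_point j)) ge0_integral_pushforward//.
by apply: measurableT_comp => //; apply/measurable_EFinP.
Qed.

(** Each point is uniform on the cube, whatever the dependence between the
    points; this alone makes the inner estimator unbiased, for randomized
    quasi-Monte Carlo as well as for Monte Carlo. *)
Lemma integral_point m (j : 'I_m) y :
  (\int[D]_s (psi (u j s) y)%:E = (inner_mean psi y)%:E)%E.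
Proof.
rewrite /inner_mean /Rintegral fineK; last exact: integrable_fin_num.
rewrite -(eq_measure_integral _ (law_point j)) [RHS]integral_pushforward//.
- by apply/measurable_EFinP; exact: mpsi.
- exact: integrable_point.
Qed.

Lemma integral_inner_estimator m y : (0 < m)%N ->
  D.-integrable setT (fun s => (inner_estimator psi u m y s)%:E) /\
  (\int[D]_s (inner_estimator psi u m y s)%:E = (inner_mean psi y)%:E)%E.
Proof.
move=> m0.
have isum : D.-integrable setT (fun s => (\sum_(j < m) psi (u j s) y)%:E).
  under eq_fun do rewrite -sumEFin.
  by apply: integrable_sum => // j _; exact: integrable_point.
split.
  by under eq_fun do rewrite EFinM; exact: integrableZl.
under eq_integral do rewrite EFinM.
rewrite integralZl//; under eq_integral do rewrite -sumEFin.
rewrite integral_sum//; last by move=> j; exact: integrable_point.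
under eq_bigr do rewrite integral_point.
rewrite sumEFin sumr_const card_ord -EFinM -[X in _ * X]mulr_natl mulKf// pnatr_eq0.
by rewrite -lt0n.
Qed.

(** For a frozen scenario the factor [phi] is a constant and the inner estimator
    is unbiased. *)
Lemma inner_error_mean0 m (phi : R -> R) : (0 < m)%N ->
  measurable_fun setT phi ->
  let err t := (inner_estimator psi u m (omega t) (Z t)
    - inner_mean psi (omega t)) * phi (inner_mean psi (omega t)) in
  P.-integrable setT (EFin \o err) -> (\int[P]_t (err t)%:E = 0)%E.
Proof.
move=> m0 mphi err ierr.
pose F (z : Omega * S) :=
  (inner_estimator psi u m z.1 z.2 - inner_mean psi z.1) * phi (inner_mean psi z.1).
have mg1 : measurable_fun setT (fun z : Omega * S => inner_mean psi z.1).
  by apply: (measurableT_comp measurable_inner_mean); exact: measurable_fst.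
have mF : measurable_fun setT F.
  apply: measurable_funM; last exact: measurableT_comp mg1.
  by apply: measurable_funB => //; exact: measurable_inner_estimator.
rewrite (independent_pair_fubini omega_Z_indep mF)//.
apply: integral0_eq => y _; rewrite /F/=.
have [iE EE] := integral_inner_estimator y m0.
have ic : D.-integrable setT (fun=> (inner_mean psi y)%:E).
  exact: finite_measure_integrable_cst.
under eq_integral do rewrite EFinM.
rewrite integralZr//; last first.
  by under eq_fun do rewrite EFinB; exact: integrableB.
under eq_integral do rewrite EFinB.
have D1 : D setT = 1%E by exact: probability_setT.
rewrite integralB_EFin// EE integral_cst// [X in (_ - _ * X)%E]D1.
by rewrite mule1 subee// mul0e.
Qed.

End inner_estimator.

(** * Mean squared error of sums of independent variables *)

Section square_integrable.
Context d (T : measurableType d) (R : realType) (P : probability T R).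

Definition square_integrable (f : T -> R) : Prop :=
  measurable_fun setT f /\ P.-integrable setT (fun t => (f t ^+ 2)%:E).

Lemma integrable_mul f g : square_integrable f -> square_integrable g ->
  P.-integrable setT (fun t => (f t * g t)%:E).
Proof.
move=> [mf if2] [mg ig2].
apply: (le_integrable _ _ _ (integrableD _ if2 ig2)) => //.
  exact/measurable_EFinP/measurable_funM.
move=> t _; rewrite -EFinD lee_fin [leRHS]ger0_norm ?addr_ge0 ?sqr_ge0//.
by case: (ger0P (f t * g t)) => _; nra.
Qed.

Lemma square_integrable_cst a : square_integrable (cst a).
Proof. by split=> //; exact: (finite_measure_integrable_cst P (a ^+ 2)). Qed.

Lemma square_integrable_integrable f : square_integrable f ->
  P.-integrable setT (EFin \o f).
Proof.
move=> sf; apply: eq_integrable (integrable_mul (square_integrable_cst 1) sf) => //.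
by move=> t _ /=; rewrite mul1r.
Qed.

Lemma square_integrableMD a f g : square_integrable f -> square_integrable g ->
  square_integrable (fun t => a * f t + g t).
Proof.
move=> sf sg; case: (sf) (sg) => mf if2 [mg ig2]; split.
  by apply: measurable_funD => //; exact: measurable_funM.
have := integrableD measurableT (integrableZl measurableT (a ^+ 2) if2)
  (integrableD measurableT (integrableZl measurableT (2 * a) (integrable_mul sf sg)) ig2).
apply: eq_integrable => // t _.
by rewrite /= -!EFinM -!EFinD; congr _%:E; ring.
Qed.

Lemma Rintegral_sqrMD a f g : square_integrable f -> square_integrable g ->
  \int[P]_t (a * f t + g t) ^+ 2 = a ^+ 2 * \int[P]_t (f t ^+ 2)
    + (2 * a * \int[P]_t (f t * g t) + \int[P]_t (g t ^+ 2)).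
Proof.
move=> sf sg; case: (sf) (sg) => mf if2 [mg ig2].
have ifg := integrable_mul sf sg.
have i1 : P.-integrable setT (fun t => (a ^+ 2 * f t ^+ 2)%:E).
  by under eq_fun do rewrite EFinM; exact: integrableZl.
have i2 : P.-integrable setT (fun t => (2 * a * (f t * g t))%:E).
  by under eq_fun do rewrite EFinM; exact: integrableZl.
have i3 : P.-integrable setT (fun t => (2 * a * (f t * g t) + g t ^+ 2)%:E).
  by under eq_fun do rewrite EFinD; exact: integrableD.
rewrite -!RintegralZl// -RintegralD// -RintegralD//.
by apply: eq_Rintegral => t _; ring.
Qed.

End square_integrable.

Section independent_sums.
Context d (T : measurableType d) (R : realType) (P : probability T R).
Variables (I : eqType) (D : set I) (X : I -> T -> R).
Hypothesis X_indep : mutually_independent P D X.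
Hypothesis X_sq : forall i, D i -> square_integrable P (X i).

Lemma mutually_independent_pair i j : D i -> D j -> i != j ->
  independent_pair P (X i) (X j).
Proof.
move=> Di Dj ij A1 A2 mA1 mA2; case: X_indep => _.
move=> /(_ [:: i; j] (fun k => if k == i then A1 else A2)).
rewrite !big_cons big_nil mule1 eqxx eq_sym (negbTE ij) => <-.
- congr (P _); apply/seteqP; split=> t /=.
    move=> [t1 t2] k /=; rewrite !inE => /orP[] /eqP ->; rewrite ?eqxx//.
    by rewrite eq_sym (negbTE ij).
  move=> h; split.
    by have := h i (mem_head _ _); rewrite eqxx.
  have ji : j \in [:: i; j] by rewrite mem_seq2 eqxx orbT.
  by have := h j ji; rewrite eq_sym (negbTE ij).
- by rewrite /= inE ij.
- by move=> k /=; rewrite !inE => /orP[] /eqP ->.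
- by move=> k; case: ifP.
Qed.

Lemma Rintegral_mul_independent i j : D i -> D j -> i != j ->
  \int[P]_t (X i t * X j t) = \int[P]_t X i t * \int[P]_t X j t.
Proof.
move=> Di Dj ij; have [mi mj] := ((X_sq Di).1, (X_sq Dj).1).
pose Xi : {RV P >-> R} := HB.pack (X i) (isMeasurableFun.Build _ _ _ _ _ mi).
pose Xj : {RV P >-> R} := HB.pack (X j) (isMeasurableFun.Build _ _ _ _ _ mj).
have ii := square_integrable_integrable (X_sq Di).
have jj := square_integrable_integrable (X_sq Dj).
have := @expectation_mul_independent _ _ _ P Xi Xj
  (mutually_independent_pair Di Dj ij) ii jj (integrable_mul (X_sq Di) (X_sq Dj)).
rewrite !unlock => E; rewrite /Rintegral -fineM; last 2 first.
- exact: integrable_fin_num.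
- exact: integrable_fin_num.
by rewrite -E.
Qed.

Variable a : I -> R.

Lemma square_integrable_sum (s : seq I) (b : R) : [set` s] `<=` D ->
  square_integrable P (fun t => \sum_(i <- s) a i * X i t + b).
Proof.
elim: s => [|i s IHs] sD.
  by under eq_fun do rewrite big_nil add0r; exact: square_integrable_cst.
under eq_fun do rewrite big_cons -addrA.
apply: square_integrableMD; first by apply: X_sq; apply: sD; rewrite /= mem_head.
by apply: IHs => j js; apply: sD; rewrite /= inE [j \in s]js orbT.
Qed.

Lemma Rintegral_mul_sum (s : seq I) (b : R) i : D i -> i \notin s ->
    [set` s] `<=` D ->
  \int[P]_t (X i t * (\sum_(j <- s) a j * X j t + b)) =
  \int[P]_t X i t * (\sum_(j <- s) a j * \int[P]_t X j t + b).
Proof.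
move=> Di; elim: s => [|j s IHs] is_ sD.
  under eq_Rintegral do rewrite big_nil add0r.
  rewrite big_nil add0r RintegralZr//.
  exact/square_integrable_integrable/X_sq.
have Dj : D j by apply: sD; rewrite /= mem_head.
have sD' : [set` s] `<=` D.
  by move=> k ks; apply: sD; rewrite /= inE [k \in s]ks orbT.
move: is_; rewrite inE negb_or => /andP[ij is_].
under eq_Rintegral do rewrite big_cons -addrA mulrDr mulrCA.
have iij := integrable_mul (X_sq Di) (X_sq Dj).
have aij : P.-integrable setT (fun t => (a j * (X i t * X j t))%:E).
  by under eq_fun do rewrite EFinM; exact: integrableZl.
have is_sum := integrable_mul (X_sq Di) (square_integrable_sum b sD').
rewrite RintegralD//.
rewrite RintegralZl// Rintegral_mul_independent// IHs// big_cons.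
ring.
Qed.

(** Variances add, and each is bounded by the second moment.  The induction adds
    one term to the sum: independence makes the cross term the product of the
    means, which is the one of the square on the right-hand side. *)
Lemma mse_independent_sum (s : seq I) (b : R) : uniq s -> [set` s] `<=` D ->
  \int[P]_t (\sum_(i <- s) a i * X i t + b) ^+ 2 <=
  \sum_(i <- s) a i ^+ 2 * \int[P]_t (X i t ^+ 2)
    + (\sum_(i <- s) a i * \int[P]_t X i t + b) ^+ 2.
Proof.
elim: s => [_ _|i s IHs /andP[is_ us] sD].
  under eq_Rintegral do rewrite big_nil add0r.
  rewrite !big_nil !add0r Rintegral_cst//.
  by rewrite [X in fine X](_ : _ = 1%E) ?mulr1//; exact: probability_setT.
have Di : D i by apply: sD; rewrite /= mem_head.
have sD' : [set` s] `<=` D.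
  by move=> k ks; apply: sD; rewrite /= inE [k \in s]ks orbT.
under eq_Rintegral do rewrite big_cons -addrA.
rewrite Rintegral_sqrMD//; last 2 first.
- exact: X_sq.
- exact: square_integrable_sum.
rewrite Rintegral_mul_sum// !big_cons.
have := IHs us sD'; set S := \int[P]_t _; set mi := \int[P]_t X i t.
set A := \sum_(_ <- _) _; set E := \sum_(_ <- _) _ => le_S.
have := sqr_ge0 (a i * mi); nra.
Qed.

End independent_sums.

(** Both integrals are integrals against the common law. *)
Lemma same_law_integral d d' (T : measurableType d) (T' : measurableType d')
    (R : realType) (P : probability T R) (P' : probability T' R)
    (X : T -> R) (X' : T' -> R) (h : R -> R) :
  measurable_fun setT X -> measurable_fun setT X' -> same_law P P' X X' ->
  measurable_fun setT h -> P.-integrable setT (fun t => (h (X t))%:E) ->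
  P'.-integrable setT (fun t => (h (X' t))%:E) /\
  \int[P']_t h (X' t) = \int[P]_t h (X t).
Proof.
move=> mX mX' XX' mh ih.
pose Xv : {RV P >-> R} := HB.pack X (isMeasurableFun.Build _ _ _ _ _ mX).
pose Xv' : {RV P' >-> R} := HB.pack X' (isMeasurableFun.Build _ _ _ _ _ mX').
have lawE A : measurable A -> A `<=` setT ->
    distribution P' Xv' A = distribution P Xv A.
  by move=> mA _; apply/esym/XX'.
have mh' : measurable_fun setT (EFin \o h) by exact/measurable_EFinP.
have ih' : P'.-integrable setT (fun t => (h (X' t))%:E).
  apply/integrableP; split; first exact: (measurableT_comp mh' mX').
  have /integrableP[_] := ih.
  rewrite -(@ge0_integral_distribution _ _ _ _ _ P Xv (fun x => `|(h x)%:E|%E))//;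
    last exact: measurableT_comp.
  rewrite -(eq_measure_integral _ lawE) ge0_integral_distribution//.
  exact: measurableT_comp.
split => //; rewrite /Rintegral; congr fine.
rewrite -(@integral_distribution _ _ _ _ _ P' Xv' (EFin \o h))//.
by rewrite (eq_measure_integral _ lawE) integral_distribution.
Qed.

(** The double sum of the estimator becomes a single sum over the pairs of a
    level and a replication, to which [mse_independent_sum] applies; the [N l]
    equal contributions of a level add up to [(N l)^-1] times its second
    moment. *)
Lemma mlmc_mse d d' (T : measurableType d) (T' : measurableType d')
    (R : realType) (P : probability T R) (P' : probability T' R)
    (Y : nat -> T -> R) (L : nat) (N : nat -> nat) (Yrep : nat -> nat -> T' -> R)
    (theta : R) :
  (forall l, (l <= L)%N -> (0 < N l)%N) ->
  (forall l, square_integrable P (Y l)) ->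
  mlmc_replications P P' Y L N Yrep ->
  ('E_P'[fun t => ((mlmc_estimator L N Yrep t - theta) ^+ 2)%R] <=
   (\sum_(l < L.+1) (N l)%:R^-1 * \int[P]_t (Y l t ^+ 2)
    + (\sum_(l < L.+1) \int[P]_t (Y l t) - theta) ^+ 2)%:E)%E.
Proof.
move=> N0 sY [Ylaw Yind].
set D := [set li : nat * nat | _] in Yind.
set X := (fun li => Yrep li.1 li.2) in Yind.
have mX li : D li -> measurable_fun setT (X li) by move=> ?; case: Yind => + _; apply.
have lawX li (h : R -> R) : D li -> measurable_fun setT h ->
    P.-integrable setT (fun t => (h (Y li.1 t))%:E) ->
  P'.-integrable setT (fun t => (h (X li t))%:E) /\
  \int[P']_t h (X li t) = \int[P]_t h (Y li.1 t).
  move=> Dli mh ih; apply: same_law_integral => //; first by case: (sY li.1).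
    exact: mX.
  by case: Dli => h1 h2; exact: Ylaw.
have msqr : measurable_fun setT (fun x : R => x ^+ 2).
  exact: (measurable_funX 2 (@measurable_id _ _ setT)).
have sX li : D li -> square_integrable P' (X li).
  move=> Dli; split; first exact: mX.
  by have [] := lawX li (fun x => x ^+ 2) Dli msqr (sY li.1).2.
have EX2 li : D li -> \int[P']_t (X li t ^+ 2) = \int[P]_t (Y li.1 t ^+ 2).
  by move=> Dli; have [] := lawX li (fun x => x ^+ 2) Dli msqr (sY li.1).2.
have EX li : D li -> \int[P']_t (X li t) = \int[P]_t (Y li.1 t).
  move=> Dli; have [] := lawX li id Dli (@measurable_id _ _ setT)
    (square_integrable_integrable (sY li.1)).
  by [].
pose s := [seq (l, i) | l <- iota 0 L.+1, i <- iota 0 (N l)].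
have sD : [set` s] `<=` D.
  move=> _ /= /allpairsPdep[l [i [+ + ->]]].
  by rewrite !mem_iota /= !add0n.
have us : uniq s.
  apply: allpairs_uniq_dep; [exact: iota_uniq|by move=> l _; exact: iota_uniq|].
  by move=> [l i] [l' i'] _ _ [-> ->].
pose a (li : nat * nat) : R := (N li.1)%:R^-1.
have sumE (F : nat * nat -> R) : \sum_(li <- s) a li * F li =
    \sum_(l < L.+1) (N l)%:R^-1 * \sum_(i < N l) F (l : nat, i : nat).
  rewrite /s big_allpairs_dep/= -(big_mkord xpredT
    (fun l => (N l)%:R^-1 * \sum_(i < N l) F (l, i : nat))) /index_iota subn0.
  apply: eq_bigr => l _; rewrite /a/= -big_distrr/=.
  by rewrite -(big_mkord xpredT (fun i => F (l, i))) /index_iota subn0.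
have eE t : mlmc_estimator L N Yrep t - theta = \sum_(li <- s) a li * X li t - theta.
  by rewrite sumE.
have avg (w : nat -> R) (v : nat -> R) : \sum_(l < L.+1) w l * v l =
    \sum_(l < L.+1) (N l)%:R^-1 * \sum_(i < N l) (w l * v l).
  apply: eq_bigr => l _; rewrite sumr_const card_ord -[X in _ = _ * X]mulr_natl mulKf//.
  by rewrite pnatr_eq0 -lt0n N0// -ltnS.
have [mE iE] := square_integrable_sum sX a (- theta) sD.
have -> : ('E_P'[fun t => ((mlmc_estimator L N Yrep t - theta) ^+ 2)%R] =
    (\int[P']_t (\sum_(li <- s) a li * X li t - theta) ^+ 2)%R%:E)%E.
  rewrite unlock /Rintegral fineK; last exact: integrable_fin_num.
  by apply: eq_integral => t _; rewrite eE.
rewrite lee_fin; apply: le_trans (mse_independent_sum Yind sX a (- theta) us sD) _.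
apply: lerD.
  rewrite (avg (fun l => (N l)%:R^-1) (fun l => \int[P]_t (Y l t ^+ 2))).
  rewrite -(sumE (fun li => (N li.1)%:R^-1 * \int[P]_t (Y li.1 t ^+ 2))).
  rewrite big_seq [leRHS]big_seq; apply: ler_sum => li lis.
  by rewrite EX2 ?expr2 ?mulrA//; exact: sD.
rewrite le_eqVlt; apply/orP; left; apply/eqP; congr ((_ - _) ^+ 2).
transitivity (\sum_(li <- s) a li * \int[P]_t (Y li.1 t)).
  by rewrite big_seq [RHS]big_seq; apply: eq_bigr => li lis; rewrite EX//; exact: sD.
rewrite (sumE (fun li => \int[P]_t (Y li.1 t))).
apply: eq_bigr => l _; rewrite /= sumr_const card_ord -[X in _ * X]mulr_natl mulKf//.
by rewrite pnatr_eq0 -lt0n N0// -ltnS.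
Qed.

(** * Choice of the levels and of the sample sizes *)

Section rates.
Variables (R : realType) (eta : R).
Hypothesis eta_ge1 : 1 <= eta.

(** Ratio between consecutive levels of the square root of variance times cost:
    variance is multiplied by [2 `^ (- (eta / 2))] and cost by [2]. *)
Definition level_ratio : R := 2 `^ ((1 - eta / 2) / 2).

Local Notation q := level_ratio.
Local Notation S L := (\sum_(l < L.+1) q ^+ l).

Let q_gt0 : 0 < q. Proof. exact: powR_gt0. Qed.

Lemma pow2_powR (a : R) (l : nat) : (2 ^+ l) `^ a = (2 `^ a) ^+ l.
Proof.
by rewrite -!powR_mulrn ?powR_ge0// -!powRrM mulrC.
Qed.

Lemma pow2_bracket (x : R) : 1 <= x -> exists L : nat, x <= 2 ^+ L <= 2 * x.
Proof.
move=> x1.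
have ex : exists n, x <= 2 ^+ n.
  exists (Num.trunc x).+1; apply: (le_trans (ltW (truncnS_gt x))).
  by rewrite -natrX ler_nat ltnW// ltn_expl.
exists (ex_minn ex); case: ex_minnP => -[|n] xn nmin.
  by rewrite xn expr0; lra.
rewrite xn/= exprS ler_pM2l// leNgt; apply/negP => /ltW /nmin.
by rewrite ltnn.
Qed.

Let sum_lt1 L : q < 1 -> S L <= (1 - q)^-1.
Proof.
move=> q1; have q1' : 0 < 1 - q by rewrite subr_gt0.
rewrite -[leRHS]mul1r ler_pdivlMr// mulrC.
have := subrX1 q L.+1; rewrite -[_ - 1]opprB -[q - 1]opprB mulNr => /oppr_inj <-.
by rewrite gerBl exprn_ge0// ltW.
Qed.

Let sum_gt1 L : 1 < q -> (S L) ^+ 2 <= (q / (q - 1)) ^+ 2 * (q ^+ 2) ^+ L.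
Proof.
move=> q1; have q1' : 0 < q - 1 by rewrite subr_gt0.
rewrite exprAC -exprMn ler_sqr ?nnegrE; last 2 first.
- by apply: sumr_ge0 => i _; rewrite exprn_ge0// ltW.
- by rewrite mulr_ge0 ?exprn_ge0 ?divr_ge0// ltW.
rewrite mulrAC ler_pdivlMr// mulrC -subrX1 -exprS.
by rewrite gerBl.
Qed.

(** The geometric sum is bounded when [2 < eta], equal to [L + 1], hence
    logarithmic, when [eta = 2], and of the order of its last term when
    [eta < 2]. *)
Lemma mlmc_rate_bound (K : R) : 1 <= K ->
  exists2 C : R, 0 < C & forall (z : R) (L : nat), expR 1 < z ->
    2 ^+ L <= 4 * K * z `^ (eta^-1) ->
    z ^+ 2 * (S L) ^+ 2 + 2 ^+ L <= C * mlmc_rate eta z^-1.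
Proof.
move=> K1; have K0 : 0 < K by exact: lt_le_trans K1.
have K4 : 0 <= 4 * K by rewrite mulr_ge0// ltW.
have eta0 : 0 < eta by exact: lt_le_trans eta_ge1.
have e1 : 1 < expR 1 :> R by rewrite -[ltLHS]expR0 ltr_expR.
have ieta1 : eta^-1 <= 1 by rewrite invf_le1.
rewrite /mlmc_rate.
have zpow z : expR 1 < z -> [/\ 1 < z, z^-1 ^- 2 = z ^+ 2, z `^ (eta^-1) <= z ^+ 2 &
    z `^ (3 / 2 + eta^-1) = z^-1 `^ (- (3 / 2) - eta^-1)].
  move=> ez; have z1 : 1 < z by exact: lt_trans ez.
  have z0 : 0 < z by exact: lt_trans z1.
  have zge0 := ltW z0.
  split=> //.
  - by rewrite exprVn invrK.
  - rewrite -powR_mulrn//; apply: ler_powR; first exact: ltW.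
    by apply: le_trans ieta1 _; rewrite ler1n.
  - rewrite -[X in X `^ (- _ - _)]powR_inv1// -powRrM; congr (_ `^ _); ring.
have [eta2|eta_le2] := ltP 2 eta.
  have q1 : q < 1.
    rewrite /level_ratio /powR gt_eqF// -[ltRHS]expR0 ltr_expR.
    by rewrite pmulr_llt0 ?ln_gt0 ?ltr1n//; lra.
  have q1' : 0 < 1 - q by rewrite subr_gt0.
  exists ((1 - q)^-1 ^+ 2 + 4 * K).
    by rewrite addr_gt0// ?exprn_gt0 ?invr_gt0// mulr_gt0.
  move=> z L ez zL; have [z1 -> zeta _] := zpow z ez.
  rewrite mulrDl lerD//.
    rewrite mulrC ler_wpM2r ?sqr_ge0// ler_sqr ?nnegrE ?sum_lt1//.
      by apply: sumr_ge0 => i _; rewrite exprn_ge0// ltW.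
    by rewrite invr_ge0 ltW.
  by apply: le_trans zL _; rewrite ler_wpM2l.
have [eta2|eta_neq2] := eqVneq eta 2.
  have q1 : q = 1 by rewrite /level_ratio eta2 divff// subrr mul0r powRr0.
  have ln2 : 0 < ln 2 :> R by rewrite ln_gt0// ltr1n.
  have ln4K : 0 <= ln (4 * K) by rewrite ln_ge0//; lra.
  pose C := (ln (4 * K) + 1) / ln 2 + 1.
  have C0 : 0 < C by rewrite ltr_wpDl// divr_ge0 ?addr_ge0// ltW.
  exists (C ^+ 2 + 4 * K).
    by rewrite addr_gt0 ?exprn_gt0// mulr_gt0.
  move=> z L ez zL; have [z1 -> zeta _] := zpow z ez.
  have z0 : 0 < z by exact: lt_trans z1.
  have zge0 := ltW z0.
  rewrite lnV ?posrE// sqrrN.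
  have lnz : 1 < ln z by rewrite -[ltLHS]expRK ltr_ln ?posrE ?expR_gt0.
  have -> : S L = L.+1%:R.
    under eq_bigr do rewrite q1 expr1n.
    by rewrite sumr_const card_ord.
  have SC : L.+1%:R <= C * ln z.
    have : ln (2 ^+ L) <= ln (4 * K) + ln z.
      rewrite -lnM ?posrE ?mulr_gt0// ler_ln ?posrE ?exprn_gt0 ?mulr_gt0//.
      apply: le_trans zL _; rewrite ler_wpM2l//.
      by rewrite -[leRHS]powRr1//; apply: ler_powR => //; exact: ltW.
    rewrite lnXn// -[X in X <= _]mulr_natl => lnL.
    have : L%:R <= (ln (4 * K) + 1) / ln 2 * ln z.
      rewrite mulrAC ler_pdivlMr//; apply: le_trans lnL _.
      by rewrite [leRHS]mulrDl mul1r lerD2r ler_peMr// ltW.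
    by move=> h; rewrite /C [leRHS]mulrDl mul1r -natr1 lerD// ltW.
  rewrite [leRHS]mulrDl lerD//.
    rewrite [leRHS]mulrCA ler_wpM2l ?sqr_ge0// -exprMn ler_sqr ?nnegrE//.
    by rewrite mulr_ge0// ltW// (lt_trans _ lnz).
  apply: le_trans zL _; rewrite ler_wpM2l//.
  by apply: le_trans zeta _; rewrite ler_peMr ?sqr_ge0// exprn_ege1// ltW.
have eta2 : eta < 2 by rewrite lt_neqAle eta_neq2.
have q1 : 1 < q.
  rewrite /level_ratio /powR gt_eqF// -[ltLHS]expR0 ltr_expR.
  by rewrite pmulr_lgt0 ?ln_gt0 ?ltr1n//; lra.
pose D := (q / (q - 1)) ^+ 2.
exists (4 * K * D + 4 * K).
  by rewrite ltr_wpDl ?mulr_gt0// mulr_ge0 ?sqr_ge0// mulr_ge0// ltW.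
move=> z L ez zL; have [z1 _ zeta <-] := zpow z ez.
have z0 : 0 < z by exact: lt_trans z1.
  have zge0 := ltW z0.
rewrite [leRHS]mulrDl lerD//; last first.
  apply: le_trans zL _; rewrite ler_wpM2l//.
  by apply: ler_powR; [exact: ltW|lra].
have b0 : 0 <= 1 - eta / 2 by lra.
have SD : (S L) ^+ 2 <= D * (4 * K * (z `^ (eta^-1 - 1 / 2))).
  apply: le_trans (sum_gt1 L q1) _; rewrite ler_wpM2l ?sqr_ge0//.
  have -> : q ^+ 2 = 2 `^ (1 - eta / 2).
    by rewrite -powR_mulrn ?powR_ge0// /level_ratio -powRrM divfK.
  rewrite -pow2_powR.
  apply: (@le_trans _ _ ((4 * K * z `^ eta^-1) `^ (1 - eta / 2))).
    by rewrite ge0_ler_powR// nnegrE ?exprn_ge0// mulr_ge0// powR_ge0.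
  rewrite powRM ?powR_ge0// -powRrM.
  have -> : eta^-1 * (1 - eta / 2) = eta^-1 - 1 / 2.
    by rewrite mulrBr mulr1 mulrA mulVf ?gt_eqF.
  rewrite ler_wpM2r ?powR_ge0// -[leRHS]powRr1//.
  by apply: ler_powR; lra.
apply: le_trans (ler_wpM2l (sqr_ge0 z) SD) _.
rewrite le_eqVlt; apply/orP; left; apply/eqP.
have -> : 3 / 2 + eta^-1 = 2 + (eta^-1 - 1 / 2) by lra.
rewrite [X in _ = _ * X]powRD; last by apply/implyP => _; rewrite gt_eqF.
by rewrite powR_mulrn//; ring.
Qed.

End rates.

(** Half of the squared error goes to the variance and a quarter to the squared
    bias.  The real number [A l] is the optimal sample size, proportional to the
    square root of variance over cost; rounding it up adds one sample per level,
    hence a cost of order [2 ^+ L]. *)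
Lemma mlmc_allocation (R : realType) (eta K : R) : 1 <= eta -> 1 <= K ->
  exists2 c4 : R, 0 < c4 & forall eps : R, 0 < eps < (expR 1)^-1 ->
    exists (L : nat) (N : nat -> nat),
    [/\ forall l, (0 < N l)%N,
        \sum_(l < L.+1) (N l)%:R^-1 * (K * (2 ^+ l) `^ (- (eta / 2)))
          + (K * (2 ^+ L) `^ (- eta)) ^+ 2 <= eps ^+ 2
      & \sum_(l < L.+1) (N l)%:R * (K * 2 ^+ l) <= c4 * mlmc_rate eta eps].
Proof.
move=> eta1 K1; have K0 : 0 < K by exact: lt_le_trans K1.
have eta0 : 0 < eta by exact: lt_le_trans eta1.
have [C C0 Crate] := mlmc_rate_bound eta1 K1.
pose q := level_ratio eta; have q0 : 0 < q by exact: powR_gt0.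
exists (2 * K ^+ 2 * C); first by rewrite !mulr_gt0 ?exprn_gt0.
move=> eps /andP[eps0 eps_lt].
pose z := eps^-1; have z0 : 0 < z by rewrite invr_gt0.
have ez : expR 1 < z by rewrite -[ltLHS]invrK ltf_pV2 ?posrE ?invr_gt0 ?expR_gt0.
have z1 : 1 < z by apply: lt_trans ez; rewrite -[ltLHS]expR0 ltr_expR.
have zeps : z^-1 = eps by rewrite invrK.
pose x := (2 * K * z) `^ eta^-1.
have Kz1 : 1 <= 2 * K * z by nra.
have x1 : 1 <= x.
  by rewrite -[leLHS](powRr0 (2 * K * z)); apply: ler_powR => //; rewrite invr_ge0 ltW.
(* As x ^ eta = 2 * K / eps, the bound x <= 2 ^ L brings the bias
   K * 2 ^ (- eta * L) down to eps / 2, while 2 ^ L <= 2 * x keeps the finest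
   level cheap. *)
have [L /andP[xL Lx]] := pow2_bracket x1.
pose S := \sum_(l < L.+1) q ^+ l.
have S0 : 0 < S.
  rewrite /S big_ord_recl expr0 ltr_pwDl//.
  by apply: sumr_ge0 => i _; rewrite exprn_ge0// ltW.
pose A l := 2 * K * z ^+ 2 * S * (q / 2) ^+ l.
have A0 l : 0 < A l by rewrite !mulr_gt0 ?exprn_gt0 ?divr_gt0.
exists L, (fun l => (Num.trunc (A l)).+1); split => //.
- have vE l : (2 ^+ l) `^ (- (eta / 2)) = q ^+ l * (q / 2) ^+ l :> R.
    rewrite pow2_powR -exprMn; congr (_ ^+ l).
    rewrite mulrA -expr2 -powR_mulrn ?powR_ge0// /q /level_ratio -powRrM divfK//.
    rewrite powRD; last by apply/implyP => _; rewrite pnatr_eq0.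
    by rewrite powRr1// mulrAC divff ?mul1r.
  have varL : \sum_(l < L.+1) (Num.trunc (A l)).+1%:R^-1 *
      (K * (2 ^+ l) `^ (- (eta / 2))) <= eps ^+ 2 / 2.
    apply: (@le_trans _ _ (\sum_(l < L.+1) q ^+ l * (2 * z ^+ 2 * S)^-1)).
      apply: ler_sum => l _.
      apply: (@le_trans _ _ ((A l)^-1 * (K * (2 ^+ l) `^ (- (eta / 2))))).
        rewrite ler_wpM2r ?mulr_ge0 ?powR_ge0 ?(ltW K0)//.
        by rewrite lef_pV2 ?posrE// ltW// truncnS_gt.
      rewrite vE le_eqVlt; apply/orP; left; apply/eqP; rewrite /A.
      have r0 : (q / 2) ^+ l != 0 by rewrite gt_eqF// exprn_gt0// divr_gt0.
      move: (_ ^+ l) r0 => r r0; move: (q ^+ l) => p.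
      by field; rewrite r0 !gt_eqF.
    rewrite -big_distrl/= -/S -zeps; rewrite le_eqVlt; apply/orP; left; apply/eqP.
    by field; rewrite !gt_eqF.
  have biasL : K * (2 ^+ L) `^ (- eta) <= eps / 2.
    apply: (@le_trans _ _ (K * x `^ (- eta))).
      rewrite ler_wpM2l ?(ltW K0)// !powRN lef_pV2 ?posrE ?powR_gt0 ?exprn_gt0//.
        by apply: ge0_ler_powR; rewrite ?nnegrE ?exprn_ge0 ?powR_ge0// ltW.
      by rewrite !mulr_gt0.
    rewrite /x -powRrM mulrN mulVf ?gt_eqF// powR_inv1 ?mulr_ge0 ?(ltW K0) ?(ltW z0)//.
    rewrite -zeps le_eqVlt; apply/orP; left; apply/eqP.
    by field; rewrite !gt_eqF.
  have b0 : 0 <= K * (2 ^+ L) `^ (- eta) by rewrite mulr_ge0 ?powR_ge0 ?ltW.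
  nra.
- have L4 : 2 ^+ L <= 4 * K * z `^ eta^-1.
    apply: le_trans Lx _; rewrite /x powRM ?mulr_ge0 ?(ltW K0) ?(ltW z0)//.
    rewrite (_ : 4 * K = 2 * (2 * K)); last by ring.
    rewrite -!mulrA ler_wpM2l// mulrA ler_wpM2r ?powR_ge0//.
    rewrite -[leRHS]powRr1 ?mulr_ge0 ?(ltW K0)//.
    by apply: ler_powR; [lra|rewrite invf_le1].
  have := Crate z L ez L4; rewrite zeps -/q -/S => rateL.
  apply: (@le_trans _ _ (2 * K ^+ 2 * (z ^+ 2 * S ^+ 2 + 2 ^+ L))); last first.
    rewrite -[leRHS]mulrA ler_wpM2l// mulr_ge0// sqr_ge0//.
  apply: (@le_trans _ _ (\sum_(l < L.+1)
      (2 * K ^+ 2 * z ^+ 2 * S * q ^+ l + K * 2 ^+ l))).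
    apply: ler_sum => l _.
    have trA : (Num.trunc (A l)).+1%:R <= A l + 1.
      by rewrite -natr1 lerD2r; have /andP[] := truncn_itv (ltW (A0 l)).
    apply: le_trans (ler_wpM2r _ trA) _; first by rewrite mulr_ge0 ?exprn_ge0 ?ltW.
    rewrite mulrDl mul1r lerD2r le_eqVlt; apply/orP; left; apply/eqP.
    rewrite /A expr_div_n; field; rewrite expf_neq0//.
  rewrite big_split/= -!big_distrr/= -/S.
  have pow2sum : \sum_(i < L.+1) 2 ^+ i = 2 ^+ L.+1 - 1 :> R.
    by rewrite subrX1 (_ : 2 - 1 = 1) ?mul1r//; ring.
  rewrite pow2sum [2 ^+ L.+1]exprS; have : 0 < 2 ^+ L :> R by rewrite exprn_gt0.
  move: (2 ^+ L) => p p0.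
  have : K * p <= K ^+ 2 * p by rewrite ler_wpM2r ?(ltW p0)// expr2 ler_peMl// ltW.
  have -> : 2 * K ^+ 2 * (z ^+ 2 * S ^+ 2 + p) =
    2 * K ^+ 2 * z ^+ 2 * S * S + 2 * (K ^+ 2 * p) by ring.
  lra.
Qed.

(** * Errors and second moments of the levels *)

Section nested_simulation.
Context (R : realType) dT (T : measurableType dT) (P : probability T R)
  dO (Omega : measurableType dO) (omega : {RV P >-> Omega})
  dS (S : measurableType dS) (Z : {RV P >-> S}) (d : nat)
  (psi : d.-tuple R -> Omega -> R) (u : forall m, 'I_m -> {mfun S >-> d.-tuple R})
  (c : R) (eta : R) (l0 : nat).
Hypotheses (omega_Z_indep : independent_pair P omega Z)
  (psi_meas : measurable_fun [set: d.-tuple R * Omega]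
                (fun vy => psi vy.1 vy.2))
  (psi_int : forall y,
    (uniform_cube R d).-integrable setT (fun v => (psi v y)%:E))
  (u_unif : forall m (j : 'I_m) A, measurable A ->
    P [set t | A (u j (Z t))] = uniform_cube R d A)
  (eta_ge1 : 1 <= eta).

Local Notation lambda := (@lebesgue_measure R).
Let G t := inner_mean psi (omega t).
Let ghat m t := inner_estimator psi u m (omega t) (Z t).
Let W m t := m%:R `^ (eta / 2) * (ghat m t - G t).
Let exceeds t : R := (c < G t)%R%:R.

Variables (p : nat -> R -> R -> R) (f : nat -> nat -> R -> R) (B : R).
Hypotheses
  (p_density : forall m, (0 < m)%N ->
    has_density P (lebesgue_measure \x lebesgue_measure)%E
      (fun t => (G t, W m t)) (fun xy => p m xy.1 xy.2))
  (p_derivable : forall m x y, (0 < m)%N ->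
    derivable (fun x' => p m x' y) x 1)
  (f_meas : forall i m, (i <= 2)%N -> (0 < m)%N ->
    measurable_fun setT (f i m))
  (p_le : forall i m x y, (i <= 2)%N -> (0 < m)%N ->
    `|derive1n i (fun x' => p m x' y) x| <= f i m y)
  (f0B : forall m, (0 < m)%N ->
    (\int[lambda]_y (`|y| * f 0 m y)%:E <= B%:E)%E)
  (f1B : forall m, (0 < m)%N ->
    (\int[lambda]_y (`|y| * f 1 m y)%:E <= B%:E)%E)
  (f1B2 : forall m, (0 < m)%N ->
    (\int[lambda]_y (`|y| ^+ 2 * f 1 m y)%:E <= B%:E)%E).

Let delta m : R := m%:R `^ (- (eta / 2)).

Let delta_gt0 m : (0 < m)%N -> 0 < delta m.
Proof. by move=> m0; rewrite powR_gt0// ltr0n. Qed.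

Let p_increment m x y : (0 < m)%N ->
  `|p m x y - p m c y| <= f 1 m y * `|x - c|.
Proof.
move=> m0; apply: (@bounded_derivative_increment _ (p m ^~ y)) => z.
  exact: p_derivable.
exact: (p_le z y (isT : (1 <= 2)%N)).
Qed.

Let p_bound m x y : (0 < m)%N -> `|p m x y| <= f 0 m y.
Proof. by move=> m0; exact: (p_le x y (isT : (0 <= 2)%N)). Qed.

Let mf0 m : (0 < m)%N -> measurable_fun setT (f 0 m).
Proof. exact: f_meas. Qed.

Let mf1 m : (0 < m)%N -> measurable_fun setT (f 1 m).
Proof. exact: f_meas. Qed.

(* Here inner_error_mean0 is applied to an indicator scaled by m ^ (eta / 2), the
   factor between W and the error of the inner estimator. *)
Let error_mean0 m h : (0 < m)%N -> 0 < h ->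
  (\int[P]_t (W m t * \1_`]c, c + h] (G t))%:E = 0)%E.
Proof.
move=> m0 h0; pose phi x : R := m%:R `^ (eta / 2) * \1_`]c, c + h] x.
have mphi : measurable_fun setT phi by exact: measurable_funM.
have E t : W m t * \1_`]c, c + h] (G t) = (ghat m t - G t) * phi (G t).
  by rewrite /W /phi; ring.
under eq_integral do rewrite E.
apply: (inner_error_mean0 omega_Z_indep psi_meas psi_int u_unif m0 mphi).
have := integrable_strip c (p_density m0) (mf0 m0)
  (fun x y => p_bound x y m0) (f0B m0) h0.
by apply: eq_integrable => // t _ /=; rewrite E.
Qed.

Let jumpE m t : (0 < m)%N ->
  jump c (delta m) (G t, W m t) = (c < ghat m t)%R%:R - exceeds t.
Proof.
move=> m0; rewrite /jump/= /W /delta powRN mulKf; last first.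
  by rewrite gt_eqF// powR_gt0// ltr0n.
by rewrite (addrC (G t)) subrK.
Qed.

Lemma indicator_strong_error m : (0 < m)%N ->
  (\int[P]_t `|((c < ghat m t)%R%:R - exceeds t)%:E| <= (2 * delta m * B)%:E)%E.
Proof.
move=> m0; under eq_integral do rewrite -jumpE//.
exact: (threshold_strong_error c (p_density m0) (mf0 m0)
  (fun x y => p_bound x y m0) (f0B m0) (delta_gt0 m0)).
Qed.

Lemma indicator_weak_error m : (0 < m)%N ->
  `|\int[P]_t ((c < ghat m t)%R%:R - exceeds t)| <= 2 * delta m ^+ 2 * B.
Proof.
move=> m0; under eq_Rintegral do rewrite -jumpE//.
exact: (threshold_weak_error (p_density m0) (mf0 m0) (mf1 m0)
  (fun x y => p_bound x y m0) (fun x y => p_increment x y m0)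
  (f0B m0) (f1B m0) (f1B2 m0) (fun h => error_mean0 m0) (delta_gt0 m0)).
Qed.

Let I l : T -> R := level_indicator psi u omega Z c l0 l.

Let Y l : T -> R := level_term psi u omega Z c l0 l.

Let m_gt0 l : (0 < level_size l0 l)%N.
Proof. by rewrite expn_gt0. Qed.

Let measurable_above (h : T -> R) : measurable_fun setT h ->
  measurable_fun setT (fun t => (c < h t)%R%:R : R).
Proof.
move=> mh; rewrite (_ : (fun t => _) = \1_(h @^-1` `]c, +oo[)).
  apply: measurable_indic; rewrite -[X in measurable X]setTI; exact: mh.
apply/funext => t; rewrite indicE; congr (nat_of_bool _)%:R.
by apply/idP/idP; rewrite inE/= in_itv/= andbT.
Qed.

Let mG : measurable_fun setT G.
Proof. exact: (measurableT_comp (measurable_inner_mean psi_meas)). Qed.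

Let mI l : measurable_fun setT (I l).
Proof.
apply: measurable_above.
have m2 : measurable_fun setT (fun t => (omega t, Z t)).
  exact: measurable_fun_pair.
exact: (measurableT_comp (measurable_inner_estimator psi_meas u _) m2).
Qed.

Let mexceeds : measurable_fun setT exceeds.
Proof. exact: measurable_above. Qed.

Let bounded1_integrable (h : T -> R) : measurable_fun setT h ->
  (forall t, `|h t| <= 1) -> P.-integrable setT (EFin \o h).
Proof.
move=> mh h1.
have i1 : P.-integrable setT (EFin \o cst 1) by exact: finite_measure_integrable_cst.
apply: (le_integrable _ _ _ i1) => //.
  exact/measurable_EFinP.
by move=> t _; rewrite /= lee_fin normr1.
Qed.

Let I_le1 l t : `|I l t| <= 1.
Proof. by rewrite /I /level_indicator; case: (c < _); rewrite ?normr1 ?normr0. Qed.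

Let exceeds_le1 t : `|exceeds t| <= 1.
Proof. by rewrite /exceeds; case: (c < _); rewrite ?normr1 ?normr0. Qed.

Let mY l : measurable_fun setT (Y l).
Proof. by case: l => [|l]; [exact: mI|exact: measurable_funB (mI _) (mI _)]. Qed.

Let Y_le1 l t : `|Y l t| <= 1.
Proof.
case: l => [|l]; first exact: I_le1.
rewrite /Y /= /level_indicator.
by do 2 case: (c < _) => /=; rewrite ?subrr ?subr0 ?sub0r ?normrN ?normr0 ?normr1.
Qed.

Lemma square_integrable_level_term l : square_integrable P (Y l).
Proof.
split; first exact: mY.
apply: bounded1_integrable; first exact: measurable_funX.
by move=> t; rewrite normrX exprn_ile1.
Qed.

Let delta_level l : delta (level_size l0 l) <= (2 ^+ l) `^ (- (eta / 2)).
Proof.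
rewrite /delta !powRN lef_pV2 ?posrE ?powR_gt0 ?exprn_gt0 ?ltr0n//.
apply: ge0_ler_powR; rewrite ?nnegrE ?exprn_ge0//.
  by rewrite divr_ge0// (le_trans _ eta_ge1).
by rewrite /level_size natrX exprD ler_peMr ?exprn_ge0// exprn_ege1// ler1n.
Qed.

Let B_ge0 : 0 <= B.
Proof.
rewrite -lee_fin; apply: le_trans (f0B (ltn0Sn 0)); apply: integral_ge0 => y _.
by rewrite lee_fin mulr_ge0// (le_trans (normr_ge0 (p 1 0 y)))// p_bound.
Qed.

Let abs_error l : \int[P]_t `|I l t - exceeds t| <= 2 * delta (level_size l0 l) * B.
Proof.
rewrite -lee_fin; apply: le_trans (indicator_strong_error (m_gt0 l)).
by rewrite /Rintegral fineK//; apply: integrable_fin_num => //;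
  apply: bounded1_integrable; [apply: measurableT_comp => //; exact: measurable_funB|];
  move=> t; rewrite normr_id /I /level_indicator /exceeds;
  do 2 case: (c < _) => /=; rewrite ?subrr ?subr0 ?sub0r ?normrN ?normr0 ?normr1.
Qed.

(* The factor 2 ^ (eta / 2) is the ratio between the errors of two consecutive
   levels, both of which enter a level term; the summand 1 is for level 0. *)
Let level_constant : R := 1 + 2 * B * (1 + 2 `^ (eta / 2)).

(** A level term takes values in {-1, 0, 1}, so that its square is at most the
    sum of the distances of its two indicators to the exact one. *)
Lemma level_term_second_moment l :
  \int[P]_t (Y l t ^+ 2) <= level_constant * (2 ^+ l) `^ (- (eta / 2)).
Proof.
have K1 : 1 <= level_constant.
  by rewrite lerDl !mulr_ge0// addr_ge0// powR_ge0.
case: l => [|l].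
  rewrite expr0 powR1 mulr1; apply: le_trans K1.
  rewrite -[leRHS](_ : \int[P]_t 1 = 1); last first.
    by rewrite Rintegral_cst// mul1r [X in fine X](_ : _ = 1%E)//; exact: probability_setT.
  apply: le_Rintegral => //.
  - exact: (square_integrable_level_term 0).2.
  - exact: finite_measure_integrable_cst.
  - by move=> t _; rewrite -real_normK ?num_real// exprn_ile1.
have iabs k : P.-integrable setT (EFin \o (fun t => `|I k t - exceeds t|)).
  apply: bounded1_integrable; first by apply: measurableT_comp => //; exact: measurable_funB.
  move=> t; rewrite normr_id /I /level_indicator /exceeds.
  by do 2 case: (c < _) => /=; rewrite ?subrr ?subr0 ?sub0r ?normrN ?normr0 ?normr1.
apply: (@le_trans _ _ (\int[P]_t (`|I l.+1 t - exceeds t| + `|I l t - exceeds t|))).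
  apply: le_Rintegral => //.
  - exact: (square_integrable_level_term l.+1).2.
  - by have := integrableD measurableT (iabs l.+1) (iabs l).
  move=> t _; rewrite /Y /= /I /level_indicator /exceeds.
  by do 3 case: (c < _) => /=; rewrite ?subrr ?subr0 ?sub0r ?normrN ?normr0 ?normr1; lra.
rewrite RintegralD//; apply: le_trans (lerD (abs_error l.+1) (abs_error l)) _.
set v := (2 ^+ l.+1) `^ _.
have d1 := delta_level l.+1; have := delta_level l.
have -> : (2 ^+ l) `^ (- (eta / 2)) = 2 `^ (eta / 2) * v.
  rewrite /v exprS powRM ?exprn_ge0// mulrA -powRD; last by apply/implyP => _; rewrite gt_eqF.
  by rewrite subrr powRr0 mul1r.
move=> d0; rewrite -/v in d1.
have v0 : 0 <= v by exact: powR_ge0.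
have := ler_wpM2l B_ge0 d1; have := ler_wpM2l B_ge0 d0.
rewrite /level_constant; nra.
Qed.

(** The sum telescopes to the finest indicator. *)
Lemma level_term_bias L :
  `|\sum_(l < L.+1) \int[P]_t (Y l t)
     - fine (P [set t | c < inner_mean psi (omega t)])|
  <= level_constant * (2 ^+ L) `^ (- eta).
Proof.
have iI l : P.-integrable setT (EFin \o I l) by exact: bounded1_integrable.
have -> : \sum_(l < L.+1) \int[P]_t (Y l t) = \int[P]_t (I L t).
  elim: L => [|L IHL]; first by rewrite big_ord_recl big_ord0 addr0.
  by rewrite big_ord_recr IHL/= RintegralB//= addrC subrK.
have -> : fine (P [set t | c < inner_mean psi (omega t)]) = \int[P]_t (exceeds t).
  rewrite /Rintegral; congr fine.
  rewrite -[LHS](_ : \int[P]_t (\1_(G @^-1` `]c, +oo[) t)%:E = _)%E; last first.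
    rewrite integral_indic//; last first.
      by rewrite -[X in measurable X]setTI; exact: mG.
    rewrite setIT; congr (P _); apply/seteqP.
    by split=> t /=; rewrite in_itv/= andbT.
  apply: eq_integral => t _; rewrite indicE; congr ((nat_of_bool _)%:R%:E).
  by apply/idP/idP; rewrite inE/= in_itv/= andbT.
rewrite -RintegralB//; last exact: bounded1_integrable.
apply: le_trans (indicator_weak_error (m_gt0 L)) _.
have d1 := delta_level L; have d0 := ltW (delta_gt0 (m_gt0 L)).
have -> : (2 ^+ L) `^ (- eta) = ((2 ^+ L) `^ (- (eta / 2))) ^+ 2 :> R.
  by rewrite -[RHS]powR_mulrn ?powR_ge0// -powRrM; congr (_ `^ _); lra.
move: (_ `^ _) d1 => v d1.
have dv : delta (level_size l0 L) ^+ 2 <= v ^+ 2.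
  by rewrite ler_sqr ?nnegrE// (le_trans d0).
have := ler_wpM2l B_ge0 dv; have := sqr_ge0 v.
have : 0 <= B * 2 `^ (eta / 2) * v ^+ 2.
  by apply: mulr_ge0; [apply: mulr_ge0 => //; exact: powR_ge0|exact: sqr_ge0].
rewrite /level_constant; lra.
Qed.

End nested_simulation.

(** * The complexity theorem *)

Lemma ereal_sup_lty_bound (R : realType) (F : nat -> \bar R) :
  (forall m, (0 < m)%N -> 0 <= F m)%E ->
  (ereal_sup [set F m | m in [set m | (0 < m)%N]] < +oo)%E ->
  exists2 B : R, 0 <= B & forall m, (0 < m)%N -> (F m <= B%:E)%E.
Proof.
move=> F0; set s := ereal_sup _ => s_lty.
have Fs m : (0 < m)%N -> (F m <= s)%E.
  by move=> m0; apply: ereal_sup_ubound; exists m.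
have s0 : (0 <= s)%E by exact: le_trans (F0 1%N isT) (Fs 1%N isT).
by exists (fine s) => [|m m0]; rewrite ?fine_ge0// fineK ?Fs// ge0_fin_numE.
Qed.

(** The finitely many levels that the asymptotic bound does not control are
    absorbed by the constant. *)
Lemma cost_bound (R : realType) (l0 : nat) (cost : nat -> R) :
  (cost : nat -> R^o) =O_\oo (fun l => (level_size l0 l)%:R : R^o) ->
  exists2 K : R, 1 <= K & forall l, cost l <= K * 2 ^+ l.
Proof.
move=> /eqO_exP[k k0 [n0 _ kn]].
have level l : (level_size l0 l)%:R = 2 ^+ l * 2 ^+ l0 :> R.
  by rewrite /level_size natrX exprD.
pose K := 1 + k * 2 ^+ l0 + \sum_(i < n0) `|cost i|.
have s0 : 0 <= \sum_(i < n0) `|cost i| by exact: sumr_ge0.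
have k1 : 0 <= k * 2 ^+ l0 by rewrite mulr_ge0 ?exprn_ge0 // ltW.
exists K => [|l]; first by rewrite /K; lra.
have l1 : 1 <= 2 ^+ l :> R by rewrite exprn_ege1// ler1n.
have [nl|ln] := leqP n0 l.
  have := kn l nl; rewrite /= level [`|_ * _|]ger0_norm ?mulr_ge0 ?exprn_ge0 // => cl.
  have cl' := le_trans (ler_norm _) cl.
  by rewrite /K; nra.
have : `|cost l| <= \sum_(i < n0) `|cost i|.
  by rewrite (bigD1 (Ordinal ln))//= lerDl sumr_ge0.
have := ler_norm (cost l); rewrite /K; nra.
Qed.

Theorem mainTheorem3 (R : realType)
  (dT : measure_display) (T : measurableType dT) (P : probability T R)
  (* the scenario, and the randomness of the points *)
  (dO : measure_display) (Omega : measurableType dO) (omega : {RV P >-> Omega})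
  (dS : measure_display) (S : measurableType dS) (Z : {RV P >-> S})
  (omega_Z_indep : independent_pair P omega Z)
  (* inner simulation *)
  (d : nat) (d_gt0 : (0 < d)%N)
  (psi : d.-tuple R -> Omega -> R)
  (psi_meas : measurable_fun [set: d.-tuple R * Omega]
                (fun vy => psi vy.1 vy.2))
  (psi_int : forall y,
    (uniform_cube R d).-integrable setT (fun v => (psi v y)%:E))
  (u : forall m, 'I_m -> {mfun S >-> d.-tuple R})
  (u_unif : forall m (j : 'I_m) A, measurable A ->
    P [set t | A (u m j (Z t))] = uniform_cube R d A)
  (c : R)
  (* variance rate of the inner estimator *)
  (eta : R) (eta_ge1 : 1 <= eta)
  (sigma2 : Omega -> R) (sigma2_ge0 : forall y, 0 <= sigma2 y)
  (var_le : forall y m, (0 < m)%N ->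
    ('V_P[fun t => inner_estimator psi u m y (Z t)]
       <= (sigma2 y / m%:R `^ eta)%:E)%E)
  (* (i) *)
  (g_density : exists fg : R -> R,
    has_density P lebesgue_measure (fun t => inner_mean psi (omega t)) fg)
  (p : nat -> R -> R -> R)
  (p_density : forall m, (0 < m)%N ->
    has_density P (lebesgue_measure \x lebesgue_measure)%E
      (fun t => (inner_mean psi (omega t),
                 m%:R `^ (eta / 2) * (inner_estimator psi u m (omega t) (Z t)
                                      - inner_mean psi (omega t))))
      (fun xy => p m xy.1 xy.2))
  (p_derivable : forall m x y, (0 < m)%N ->
    derivable (fun x' => p m x' y) x 1 /\
    derivable (derive1 (fun x' => p m x' y)) x 1)
  (f : nat -> nat -> R -> R)
  (f_meas : forall i m, (i <= 2)%N -> (0 < m)%N ->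
    measurable_fun setT (f i m))
  (p_le : forall i m x y, (i <= 2)%N -> (0 < m)%N ->
    `|derive1n i (fun x' => p m x' y) x| <= f i m y)
  (f_moments : forall i (r : R), (i <= 2)%N -> 0 <= r <= 4 ->
    (ereal_sup [set \int[lebesgue_measure]_y (`|y| `^ r * f i m y)%:E
               | m in [set m | (0 < m)%N]] < +oo)%E)
  (* (ii) *)
  (rho : R -> R)
  (rho_density : has_density P lebesgue_measure
    (fun t => `|inner_mean psi (omega t) - c| / Num.sqrt (sigma2 (omega t)))
    rho)
  (rho_bounded : exists rho0 x0 : R, [/\ 0 < rho0, 0 < x0 &
    forall x, 0 <= x <= x0 -> rho x <= rho0])
  (* levels and cost *)
  (l0 : nat) (cost : nat -> R)
  (cost_O : (cost : nat -> R^o) =O_\oo (fun l => (level_size l0 l)%:R : R^o)) :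
  let theta := fine (P [set t | c < inner_mean psi (omega t)]) in
  let Y := level_term psi u omega Z c l0 in
  exists2 c4 : R, 0 < c4 &
  forall eps : R, 0 < eps < (expR 1)^-1 ->
  exists (L : nat) (N : nat -> nat),
    [/\ forall l, (l <= L)%N -> (0 < N l)%N,
        forall (dT' : measure_display) (T' : measurableType dT')
          (P' : probability T' R) (Yrep : nat -> nat -> T' -> R),
          mlmc_replications P P' Y L N Yrep ->
          ('E_P'[fun t => ((mlmc_estimator L N Yrep t - theta) ^+ 2)%R]
             <= (eps ^+ 2)%:E)%E
      & mlmc_cost L N cost <= c4 * mlmc_rate eta eps].
Proof.
move=> theta Y.
have f_ge0 i m y : (i <= 2)%N -> (0 < m)%N -> 0 <= f i m y.
  by move=> i2 m0; exact: le_trans (normr_ge0 _) (p_le i m 0 y i2 m0).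
have moment i r : (i <= 2)%N -> 0 <= r <= 4 -> exists2 B : R, 0 <= B &
    forall m, (0 < m)%N ->
      (\int[lebesgue_measure]_y (`|y| `^ r * f i m y)%:E <= B%:E)%E.
  move=> i2 r4; apply: ereal_sup_lty_bound (f_moments i r i2 r4) => m m0.
  by apply: integral_ge0 => y _; rewrite lee_fin mulr_ge0 ?powR_ge0 ?f_ge0.
have r1 : (0 : R) <= (1 : R) <= (4 : R) by apply/andP; split; lra.
have r2 : (0 : R) <= (2 : R) <= (4 : R) by apply/andP; split; lra.
have [B0 B0_ge0 m0B] := moment 0%N 1 isT r1.
have [B1 B1_ge0 m1B] := moment 1%N 1 isT r1.
have [B2 B2_ge0 m2B] := moment 1%N 2 isT r2.
pose B := B0 + B1 + B2.
have f0B m : (0 < m)%N ->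
    (\int[lebesgue_measure]_y (`|y| * f 0%N m y)%:E <= B%:E)%E.
  move=> m0; under eq_integral do rewrite -[`|_|]powRr1//.
  by apply: le_trans (m0B m m0) _; rewrite lee_fin /B; lra.
have f1B m : (0 < m)%N ->
    (\int[lebesgue_measure]_y (`|y| * f 1%N m y)%:E <= B%:E)%E.
  move=> m0; under eq_integral do rewrite -[`|_|]powRr1//.
  by apply: le_trans (m1B m m0) _; rewrite lee_fin /B; lra.
have f1B2 m : (0 < m)%N ->
    (\int[lebesgue_measure]_y (`|y| ^+ 2 * f 1%N m y)%:E <= B%:E)%E.
  move=> m0; under eq_integral do rewrite -powR_mulrn//.
  by apply: le_trans (m2B m m0) _; rewrite lee_fin /B; lra.
have second := level_term_second_moment c l0 psi_meas eta_ge1 p_density f_meas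
  p_le f0B.
have bias := level_term_bias c l0 omega_Z_indep psi_meas psi_int u_unif eta_ge1
  p_density (fun m x y m0 => (p_derivable m x y m0).1) f_meas p_le f0B f1B f1B2.
have sq := square_integrable_level_term omega Z u c l0 psi_meas.
move: second bias; set K1 := 1 + 2 * B * _ => second bias.
have [K2 K2_ge1 costK] := cost_bound cost_O.
pose K := K1 + K2.
have K1_ge0 : 0 <= K1.
  by rewrite addr_ge0// !mulr_ge0 ?addr_ge0 ?powR_ge0.
have K_ge1 : 1 <= K by rewrite /K; lra.
have [c4 c4_gt0 alloc] := mlmc_allocation eta_ge1 K_ge1.
exists c4 => // eps eps01; have [L [N [N0 mse cst]]] := alloc eps eps01.
exists L, N; split=> [l _|dT' T' P' Yrep rep|]; first exact: N0.
- apply: le_trans (mlmc_mse theta (fun l _ => N0 l) sq rep) _.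
  rewrite lee_fin; apply: le_trans mse; apply: lerD.
    apply: ler_sum => l _; rewrite ler_wpM2l ?invr_ge0//.
    apply: le_trans (second l) _; rewrite ler_wpM2r ?powR_ge0// /K; lra.
  rewrite -real_normK ?num_real// ler_sqr ?nnegrE//; last first.
    by rewrite mulr_ge0 ?powR_ge0// (le_trans _ K_ge1).
  apply: le_trans (bias L) _; rewrite ler_wpM2r ?powR_ge0// /K; lra.
- apply: le_trans cst; apply: ler_sum => l _; rewrite ler_wpM2l//.
  apply: le_trans (costK l) _; rewrite ler_wpM2r ?exprn_ge0// /K; lra.
Qed.
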